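(* Let $n\ge3$ and $s\in(0,1)$. There exists $u\in C_c(\mathbb{R}^n)$, namely $$u(y)=|y_1|^s|y|^s\chi(|y|),\qquad y=(y_1,\dots,y_n)\in\mathbb{R}^n,$$ where $\rho\in(0,1]$ is fixed with $\rho^2<\frac1{2(1-s)}$ and $\chi\in C_c([0,\infty))$ is nonnegative with $\chi(t)=t^2$ for $0\le t\le\rho$ and $4(1-s)\int_0^\infty\frac{\chi(t)}t\,dt=1$, such that $u$ can be touched from above at $x=0$ by a $C^2$-function, and it satisfies (i) $\mathcal{K}^su(0)=\eta_0$ for some $\eta_0>0$; (ii) $0\le\Theta^su(0,e)\le1$ for all $e\in\mathbb{S}^{n-1}$. However, for every $\Lambda\ge1$, $$\inf_{A\in\mathcal{A}_2\cap\mathcal{N}(\Lambda)}\mathcal{L}^s_Au(0)>\inf_{A\in\mathcal{A}_2}\mathcal{L}^s_Au(0)=\mathcal{K}^su(0).$$ Moreover, the estimate ''$\mathcal{L}_A^su(0)\ge\gamma_0\|A\|_F^{2s}$ for all $A\in\mathcal{A}_2$'' fails for every $\gamma_0>0$; i.e., there exists a degenerating family $\{A_\lambda\}\subset\mathcal{A}_2$ such that $\mathcal{L}^s_{A_\lambda}u(0)$ remains bounded as $\|A_\lambda\|_F\to\infty$.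
   Context: $\mathcal{S}^n_+$ is the set of symmetric positive definite real $n\times n$ matrices, $\|A\|_F=\sqrt{\operatorname{tr}(A^2)}$, and for $\Lambda\ge1$, $\mathcal{N}(\Lambda)=\{A\in\mathcal{S}^n_+:\Lambda^{-1}I\le A\le\Lambda I\}$. For $A\in\mathcal{S}^n_+$, $\lambda_1(A),\dots,\lambda_n(A)$ are its eigenvalues with multiplicity. Let $\sigma_1(\zeta)=\sum_i\zeta_i$, $\sigma_2(\zeta)=\sum_{i<j}\zeta_i\zeta_j$, $\Gamma_2=\{\zeta\in\mathbb{R}^n:\sigma_1(\zeta)>0,\ \sigma_2(\zeta)>0\}$ and $$\mathcal{A}_2=\Big\{A\in\mathcal{S}^n_+:\ \lambda_i(A)^2=\sum_{j\ne i}\zeta_j\ (i=1,\dots,n)\ \text{for some }\zeta\in\Gamma_2\text{ with }\sigma_2(\zeta)=1\Big\}.$$ Let $C_{n,s}=\dfrac{4^s s\,\Gamma(\frac{n+2s}{2})}{\pi^{n/2}\Gamma(1-s)}$, $\delta u(x,y)=u(x+y)+u(x-y)-2u(x)$, and $$\mathcal{L}^s_Au(x)=\frac{C_{n,s}}2\int_{\mathbb{R}^n}\frac{\delta u(x,Ay)}{|y|^{n+2s}}\,dy,\qquad\mathcal{K}^su(x)=\inf_{A\in\mathcal{A}_2}\mathcal{L}^s_Au(x),$$ $$\Theta^su(x,e)=(1-s)\int_{-\infty}^\infty\frac{\delta u(x,re)}{|r|^{1+2s}}\,dr,\quad e\in\mathbb{S}^{n-1}.$$ $u$ can be touched from above by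 a $C^2$-function at $x$ if there are an open neighborhood $N$ of $x$ and $\psi\in C^2(N)$ with $\psi(x)=u(x)$ and $\psi(y)>u(y)$ for all $y\in N\setminus\{x\}$. *)

(* Defs.v *)
From HB Require Import structures.
From mathcomp Require Import all_boot all_order all_algebra.
From mathcomp Require Import all_classical all_reals all_analysis.

Set Implicit Arguments.
Unset Strict Implicit.
Unset Printing Implicit Defensive.

Import Order.TTheory GRing.Theory Num.Theory.
Import numFieldNormedType.Exports.

Local Open Scope classical_set_scope.
Local Open Scope ring_scope.

(* The library has the product sigma-algebra on n.-tuple T but no n-fold
   product measure: Lebesgue measure on R^n is obtained from the binary product
   by transport along (x, t) |-> x :: t. *)
Section tuple_lebesgue_step.
Context {R : realType} (n : nat).
Variable mu : {sigma_finite_measure set (n.-tuple (measurableTypeR R)) -> \bar R}.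

Definition tuple_cons (p : measurableTypeR R * n.-tuple (measurableTypeR R)) :
  n.+1.-tuple (measurableTypeR R) := [the n.+1.-tuple _ of p.1 :: p.2].

Lemma measurable_tuple_cons : measurable_fun setT tuple_cons.
Proof. exact: measurable_cons. Qed.

Definition lebesgue_cons : set (n.+1.-tuple (measurableTypeR R)) -> \bar R :=
  pushforward (lebesgue_measure \x mu)%E tuple_cons.

Let lebesgue_cons0 : lebesgue_cons set0 = 0%E.
Proof. by rewrite /lebesgue_cons /pushforward preimage_set0 measure0. Qed.

Let lebesgue_cons_ge0 A : (0 <= lebesgue_cons A)%E.
Proof. by rewrite /lebesgue_cons /pushforward measure_ge0. Qed.

Let lebesgue_cons_sigma_additive : semi_sigma_additive lebesgue_cons.
Proof.
move=> F mF tF mUF; rewrite /lebesgue_cons /pushforward preimage_bigcup.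
have mpre A : measurable A -> measurable (tuple_cons @^-1` A).
  by move=> mA; rewrite -[X in measurable X]setTI; exact: measurable_tuple_cons.
apply: measure_semi_sigma_additive.
- by move=> k; exact: mpre.
- apply/trivIsetP => /= i j _ _ ij; rewrite -preimage_setI.
  by move/trivIsetP : tF => /(_ _ _ _ _ ij) ->//; rewrite preimage_set0.
- by rewrite -preimage_bigcup; exact: mpre.
Qed.

HB.instance Definition _ := isMeasure.Build _ _ _ lebesgue_cons
  lebesgue_cons0 lebesgue_cons_ge0 lebesgue_cons_sigma_additive.

Let lebesgue_cons_sigma_finite : sigma_finite setT lebesgue_cons.
Proof.
pose uncons (t : n.+1.-tuple (measurableTypeR R)) :
  measurableTypeR R * n.-tuple (measurableTypeR R) :=
  (thead t, [tuple of behead t]).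
have consK : cancel tuple_cons uncons.
  by move=> [x t]; rewrite /uncons /tuple_cons theadE; congr pair; exact/val_inj.
have unconsK : cancel uncons tuple_cons by move=> t; rewrite [RHS]tuple_eta.
have /sigma_finiteP[F [FT ndF Foo]] :=
  sigma_finiteT (@lebesgue_measure R : {sigma_finite_measure set _ -> \bar R}).
have /sigma_finiteP[G [GT ndG Goo]] := sigma_finiteT mu.
exists (fun k => uncons @^-1` (F k `*` G k)).
  rewrite -preimage_bigcup (_ : \bigcup_k _ = setT) ?preimage_setT//.
  apply/seteqP; split => // -[x t] _ /=.
  have [i _ Fx] : (\bigcup_i F i) x by rewrite -FT.
  have [j _ Gt] : (\bigcup_j G j) t by rewrite -GT.
  exists (maxn i j) => //; split => /=.
    by move: Fx; exact/subsetPset/ndF/leq_maxl.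
  by move: Gt; exact/subsetPset/ndG/leq_maxr.
move=> k; have [mF Fk] := Foo k; have [mG Gk] := Goo k; split.
  rewrite -[X in measurable X]setTI.
  have muncons : measurable_fun setT uncons.
    apply/measurable_fun_pairP; split => /=; last exact: measurable_behead.
    exact: measurable_tnth.
  by apply: muncons => //; exact: measurableX.
rewrite /lebesgue_cons /pushforward -comp_preimage.
rewrite (_ : uncons \o tuple_cons = id) ?preimage_id; last exact/funext.
by rewrite product_measure1E// lte_mul_pinfty// ge0_fin_numE.
Qed.

HB.instance Definition _ := Measure_isSigmaFinite.Build _ _ _
  lebesgue_cons lebesgue_cons_sigma_finite.

End tuple_lebesgue_step.

Fixpoint lebesgue_tuple (R : realType) (n : nat) :
    {sigma_finite_measure set (n.-tuple (measurableTypeR R)) -> \bar R} :=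
  match n with
  | 0 => \d_[tuple]
  | n'.+1 => lebesgue_cons (lebesgue_tuple R n')
  end.

Section operators.
Context {R : realType} {n : nat}.
Implicit Types (A : 'M[R]_n) (x y e : 'cV[R]_n) (u : 'cV[R]_n -> R) (s : R).

Definition enorm x : R := Num.sqrt (\sum_(i < n) x i 0 ^+ 2).

(* The library's topology on matrices is that of the sup norm, hence the usual
   topology of R^n; only lengths need enorm. *)
Definition integral_Rn (f : 'cV[R]_n -> R) : \bar R :=
  (\int[lebesgue_tuple R n]_t (f (\col_(i < n) tnth t i))%:E)%E.

Definition frobenius A : R := Num.sqrt (\tr (A *m A)).

Definition quad_form A x : R := (x^T *m A *m x) 0 0.

Definition sym_posdef A : Prop :=
  A^T = A /\ forall x, x != 0 -> 0 < quad_form A x.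

Definition loewner_le A B : Prop := forall x, quad_form A x <= quad_form B x.

Definition N_class (Lambda : R) : set 'M[R]_n :=
  [set A | [/\ sym_posdef A, loewner_le (Lambda^-1)%:M A
               & loewner_le A Lambda%:M]].

(* lam lists the eigenvalues of A with multiplicity, in some order. *)
Definition eigenvalues_of A (lam : 'I_n -> R) : Prop :=
  char_poly A = \prod_(i < n) ('X - (lam i)%:P).

Definition sigma1 (zeta : 'I_n -> R) : R := \sum_(i < n) zeta i.

Definition sigma2 (zeta : 'I_n -> R) : R :=
  \sum_(i < n) \sum_(j < n | (i < j)%N) zeta i * zeta j.

Definition Gamma2 : set ('I_n -> R) :=
  [set zeta | 0 < sigma1 zeta /\ 0 < sigma2 zeta].

(* The order of the eigenvalues is immaterial, since Gamma2 and sigma2 are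
   invariant under permutations of zeta. *)
Definition A2_class : set 'M[R]_n :=
  [set A | sym_posdef A /\
     exists lam : 'I_n -> R, eigenvalues_of A lam /\
     exists zeta : 'I_n -> R, [/\ Gamma2 zeta, sigma2 zeta = 1
       & forall i, lam i ^+ 2 = \sum_(j < n | j != i) zeta j]].

Definition GammaE (a : R) : R :=
  (\int[lebesgue_measure]_(t in `]0, +oo[) (t `^ (a - 1) * expR (- t)))%R.

Definition C_const s : R :=
  4 `^ s * s * GammaE ((n%:R + 2 * s) / 2)
    / (pi `^ (n%:R / 2) * GammaE (1 - s)).

Definition second_diff u x y : R := u (x + y) + u (x - y) - 2 * u x.

Definition L_op s A u x : \bar R :=
  ((C_const s / 2)%:E *
   integral_Rn (fun y =>
     (second_diff u x (A *m y) / enorm y `^ (n%:R + 2 * s))%R))%E.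

(* Infima are taken in \bar R, so that the infimum over the empty set is +oo:
   for n >= 3, A2_class `&` N_class Lambda is empty for Lambda close to 1. *)
Definition K_op s u x : \bar R := ereal_inf [set L_op s A u x | A in A2_class].

Definition Theta_op s u x e : \bar R :=
  ((1 - s)%:E * \int[lebesgue_measure]_r
     (second_diff u x (r *: e) / `|r| `^ (1 + 2 * s))%:E)%E.

Definition partial (i : 'I_n) u : 'cV[R]_n -> R := 'D_(delta_mx i 0) u.

Definition C1_on (N : set 'cV[R]_n) u : Prop :=
  forall i y, N y ->
    derivable u y (delta_mx i 0) /\ {for y, continuous (partial i u)}.

Definition C2_on (N : set 'cV[R]_n) u : Prop :=
  C1_on N u /\ forall i, C1_on N (partial i u).

Definition touched_from_above_C2 u x : Prop :=
  exists (N : set 'cV[R]_n) (psi : 'cV[R]_n -> R),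
    [/\ open N, N x, C2_on N psi, psi x = u x
      & forall y, N y -> y != x -> u y < psi y].

End operators.

(* For closed D, the closure in T is the support of f relative to D. *)
Definition Cc_on (R : realType) (T : topologicalType) (D : set T)
    (f : T -> R) : Prop :=
  {within D, continuous f} /\ compact (closure (D `&` [set x | f x != 0])).

Definition admissible_radius (R : realType) (s rho : R) : Prop :=
  0 < rho <= 1 /\ rho ^+ 2 < 1 / (2 * (1 - s)).

Definition admissible_profile (R : realType) (s rho : R) (chi : R -> R) : Prop :=
  [/\ Cc_on (`[0%R, +oo[ : set R) chi,
      forall t, 0 <= t -> 0 <= chi t,
      forall t, 0 <= t <= rho -> chi t = t ^+ 2
    & ((4 * (1 - s))%:E *
        \int[lebesgue_measure]_(t in `]0%R, +oo[) (chi t / t)%:E = 1)%E].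

Definition u_chi (R : realType) (n : nat) (i1 : 'I_n) (s : R) (chi : R -> R)
    (y : 'cV[R]_n) : R :=
  `|y i1 0| `^ s * enorm y `^ s * chi (enorm y).

(* Main.v *)
Require Import Defs.
From mathcomp Require Import all_boot all_order all_algebra.
From mathcomp Require Import all_classical all_reals all_analysis.
From mathcomp Require Import measurable_realfun.
From mathcomp Require Import ring lra.

(** Write e for the first basis vector and B for the unit ball, and put
      J(A) = \int_B |(A y)_1|^s |A y|^s dy,
      J_c  = \int_B |y_1|^s (c y_1^2 + |y'|^2)^(s/2) dy   with y = (y_1, y').

    Since u is even and vanishes at 0, the integrand of L_A u(0) is
    2 |(A y)_1|^s |A y|^s chi(|A y|) / |y|^(n+2s), where the first two factors
    are homogeneous of degree 2 s.  Integrating out the dilations of R^n turns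
    this into L_A u(0) = K J(A), with K > 0 the same for all A
    ([ball_average_identity], [L_op_eq]); the profile chi enters only through
    \int chi(t)/t dt.  Everything is then read off from J.

    Lower bound.  If A belongs to the class and lam_i are its eigenvalues, then
    lam_i^2 lam_j^2 >= 1 for i != j, so at most one eigenvalue is below 1 and
    it is compensated by the others: |A e| |A z| >= |z| whenever z is
    orthogonal to A e ([A2_orth_le]).  Rotate the direction of A e to that of e
    and split off the component along A^-1 e.  In the new coordinates
    (A y)_1 = |A e| y_1 and
    |A y|^2 >= |A e|^2 y_1^2 + |A e|^-2 |y' - y_1 q|^2 for some q.  The shear
    y' - y_1 q can only increase the integral over B, by a bathtub comparison
    ([ball_int_shear_ge]).  Hence J(A) >= J_c with c = |A e|^4
    ([ball_int_op_ge]), and J_c > J_0 for c > 0.  In particular J(A) >= J_0 on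
    the whole class, while |A e| >= 1 / Lambda on N(Lambda) gives
    J(A) >= J_(Lambda^-4) > J_0 there.

    Sharpness.  The matrices diag (t^(-1/2), t^(1/2), (t + 1/t)^(1/2), ...),
    with zeta = (t, 1/t, 0, ...), satisfy J <= J_0 + t^(-s) |B|
    ([degenerate_ball_int_le]).  So the infimum over the class is K J_0 > 0,
    and along this family the operator stays bounded while the Frobenius norm
    is at least t^(1/2).

    The other assertions are direct: Theta u(0, e) = |e_1|^s for a unit vector
    e; u(y) <= |y|^(2s+2) < |y|^2 for 0 < |y| < rho; and t times a
    piecewise linear tent of the right width is an admissible profile.

    The integrals over R^n only need Tonelli's theorem: translations and
    dilations are treated one coordinate at a time, shears by fixing the
    first coordinate, and rotations by the uniqueness argument of Haar measure
    ([intRn_mulmx_orth]). *)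

Set Implicit Arguments.
Unset Strict Implicit.
Unset Printing Implicit Defensive.

Import Order.TTheory GRing.Theory Num.Theory.
Import numFieldNormedType.Exports.

Local Open Scope classical_set_scope.
Local Open Scope ring_scope.

(** * Lebesgue integration over column vectors *)

Section affine_line.
Context {R : realType}.
Local Notation mu := (@lebesgue_measure R).

Lemma measurable_affine (c b : R) :
  measurable_fun setT (fun x : measurableTypeR R => c * x + b : measurableTypeR R).
Proof. by apply: measurable_funD => //; apply: measurable_funM. Qed.

(** Lebesgue measure is determined by its values on intervals, so it is [c]
    times its image under [x |-> c x + b]. *)
Lemma lebesgue_integral_affine (c b : R) (f : R -> \bar R) :
  0 < c -> measurable_fun setT f -> (forall x, (0 <= f x)%E) ->
  (\int[mu]_x f (c * x + b)%R = (c^-1)%:E * \int[mu]_x f x)%E.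
Proof.
move=> c0 mf f0.
pose phi (x : measurableTypeR R) : measurableTypeR R := c * x + b.
have mphi : measurable_fun setT phi by exact: measurable_affine.
have cnng : 0 <= c by exact: ltW.
pose nu0 : {measure set (measurableTypeR R) -> \bar R} :=
  mscale (NngNum cnng) (pushforward mu phi).
pose nu := nu0 mphi.
have E A : measurable A -> mu A = nu A.
  apply: lebesgue_measure_unique => _ [[x y]] _ <-.
  rewrite /nu /= /mscale /= /pushforward.
  have -> : phi @^-1` `]x, y]%classic = `](x - b) / c, (y - b) / c]%classic.
    apply/seteqP; split => z; rewrite /= !in_itv /= /phi.
      by rewrite ltr_pdivrMr// ler_pdivlMr// (mulrC z) ltrBlDr lerBrDr.
    by rewrite ltr_pdivrMr// ler_pdivlMr// (mulrC z) ltrBlDr lerBrDr.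
  rewrite !lebesgue_measure_itv /= !lte_fin ltr_pM2r ?invr_gt0// ltrBlDr subrK.
  case: ifP => _; last by rewrite mule0.
  by rewrite -!EFinB -EFinM; congr EFin; field; rewrite gt_eqF.
have -> : (\int[mu]_x f x = c%:E * \int[mu]_x f (c * x + b)%R)%E.
  rewrite (eq_measure_integral nu); last by move=> A mA _; exact: E.
  rewrite ge0_integral_mscale//=.
  by congr (_ * _)%E; rewrite ge0_integral_pushforward.
by rewrite muleA -EFinM mulVf ?gt_eqF// mul1e.
Qed.

End affine_line.

Section column_integral.
Context {R : realType}.
Local Notation mu := (@lebesgue_measure R).
Local Notation T := (measurableTypeR R).
Local Open Scope ereal_scope.

Definition tcol n (t : n.-tuple T) : 'cV[R]_n := \col_(i < n) tnth t i.

(** Lebesgue measure lives on tuples; measurability of a function of a column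
    is read along the identification [tcol] of tuples with columns. *)
Definition colmeas n d (Z : measurableType d) (F : 'cV[R]_n -> Z) : Prop :=
  measurable_fun setT (F \o @tcol n).

Definition intRn n (F : 'cV[R]_n -> \bar R) : \bar R :=
  \int[lebesgue_tuple R n]_t F (tcol t).

Lemma colmeas_comp n d (Z : measurableType d) (F : 'cV[R]_n -> Z)
    d' (X : measurableType d') (g : X -> 'cV[R]_n) :
  colmeas F -> (forall i, measurable_fun setT (fun x => g x i 0%R)) ->
  measurable_fun setT (F \o g).
Proof.
move=> mF mg.
pose h x : n.-tuple T := [tuple g x i 0%R | i < n].
have -> : F \o g = (F \o @tcol n) \o h.
  apply/funext => x /=; congr F; apply/colP => i.
  by rewrite mxE tnth_mktuple.
apply: measurableT_comp => //; apply/measurable_fun_tnthP => i.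
rewrite (_ : _ \o h = fun x => g x i 0%R); first exact: mg.
by apply/funext => x /=; rewrite tnth_mktuple.
Qed.

Lemma measurable_tcol n (i : 'I_n) :
  measurable_fun setT (fun t : n.-tuple T => tcol t i 0%R).
Proof.
rewrite (_ : (fun _ => _) = fun t => tnth t i); first exact: measurable_tnth.
by apply/funext => t; rewrite mxE.
Qed.

Lemma colmeas_coord n (i : 'I_n) : colmeas (fun y : 'cV[R]_n => y i 0%R).
Proof. exact: measurable_tcol. Qed.

Lemma colmeas_sum n (I : finType) (F : I -> 'cV[R]_n -> R) :
  (forall i, colmeas (F i)) -> colmeas (fun y => \sum_i F i y)%R.
Proof.
move=> mF; rewrite /colmeas (_ : _ \o _ = fun t => \sum_i F i (tcol t))%R //.
by apply: measurable_sum => i; exact: mF.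
Qed.

Lemma measurable_mulmx n m d' (X : measurableType d') (g : X -> 'cV[R]_n)
    (A : 'M[R]_(m, n)) i :
  (forall i, measurable_fun setT (fun x => g x i 0%R)) ->
  measurable_fun setT (fun x => (A *m g x) i 0%R).
Proof.
move=> mg; rewrite (_ : (fun x => _) = fun x => \sum_j A i j * g x j 0%R)%R.
  by apply: measurable_sum => j; apply: measurable_funM.
by apply/funext => x; rewrite mxE.
Qed.

Lemma colmeas_EFin n (F : 'cV[R]_n -> R) :
  colmeas F -> colmeas (fun y => (F y)%:E).
Proof. by move=> mF; apply/measurable_EFinP. Qed.

Lemma colmeas_affine n m d (Z : measurableType d) (F : 'cV[R]_n -> Z)
    (A : 'M[R]_(n, m)) (b : 'cV[R]_n) :
  colmeas F -> colmeas (fun y => F (A *m y + b)%R).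
Proof.
move=> mF; apply: (colmeas_comp (g := fun t => (A *m tcol t + b)%R) mF) => i.
rewrite (_ : (fun _ => _) = fun t => ((A *m tcol t) i 0 + b i 0))%R; last first.
  by apply/funext => t; rewrite mxE.
by apply: measurable_funD => //; apply: measurable_mulmx => j; exact: measurable_tcol.
Qed.

Lemma colmeas_shift n d (Z : measurableType d) (F : 'cV[R]_n -> Z) b :
  colmeas F -> colmeas (fun y => F (y + b)%R).
Proof.
move=> /(colmeas_affine 1%:M b); congr colmeas.
by apply/funext => y; rewrite mul1mx.
Qed.

Lemma colmeas_mulmx n m d (Z : measurableType d) (F : 'cV[R]_n -> Z)
    (A : 'M[R]_(n, m)) : colmeas F -> colmeas (fun y => F (A *m y)%R).
Proof.
move=> /(colmeas_affine A 0); congr colmeas.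
by apply/funext => y; rewrite addr0.
Qed.

Lemma colmeas_scale n d (Z : measurableType d) (F : 'cV[R]_n -> Z) c :
  colmeas F -> colmeas (fun y => F (c *: y)%R).
Proof.
move=> /(colmeas_mulmx c%:M); congr colmeas.
by apply/funext => y; rewrite mul_scalar_mx.
Qed.

Definition ccons n (x : R) (y : 'cV[R]_n) : 'cV[R]_n.+1 :=
  \col_i oapp (fun j => y j 0%R) x (unlift ord0 i).

Lemma ccons0 n x (y : 'cV[R]_n) : ccons x y ord0 0%R = x.
Proof. by rewrite mxE unlift_none. Qed.

Lemma cconsS n x (y : 'cV[R]_n) i : ccons x y (lift ord0 i) 0%R = y i 0%R.
Proof. by rewrite mxE liftK. Qed.

Lemma cconsP n (z : 'cV[R]_n.+1) x (y : 'cV[R]_n) :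
  z ord0 0%R = x -> (forall i, z (lift ord0 i) 0%R = y i 0%R) -> z = ccons x y.
Proof.
move=> z0 zS; apply/colP => i; case: (unliftP ord0 i) => [j|] ->.
  by rewrite cconsS zS.
by rewrite ccons0.
Qed.

Lemma ccons_eta n (z : 'cV[R]_n.+1) :
  z = ccons (z ord0 0%R) (\col_i z (lift ord0 i) 0%R).
Proof. by apply: cconsP => // i; rewrite mxE. Qed.

Lemma cconsD n x b (y c : 'cV[R]_n) :
  (ccons x y + ccons b c)%R = ccons (x + b)%R (y + c)%R.
Proof.
by apply: cconsP => [|i]; rewrite [LHS]mxE ?ccons0 // !cconsS [RHS]mxE.
Qed.

Lemma cconsZ n a x (y : 'cV[R]_n) : (a *: ccons x y)%R = ccons (a * x)%R (a *: y)%R.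
Proof.
by apply: cconsP => [|i]; rewrite [LHS]mxE ?ccons0 // !cconsS [RHS]mxE.
Qed.

Lemma colmeas_cons n d (Z : measurableType d) (F : 'cV[R]_n.+1 -> Z) (x : R) :
  colmeas F -> colmeas (fun y => F (ccons x y)).
Proof.
move=> mF; apply: (colmeas_comp (g := fun t => ccons x (tcol t)) mF) => i.
case: (unliftP ord0 i) => [j|] ->.
  rewrite (_ : (fun _ => _) = fun t => tcol t j 0%R); first exact: measurable_tcol.
  by apply/funext => t; rewrite cconsS.
rewrite (_ : (fun _ => _) = cst x) //.
by apply/funext => t; rewrite ccons0.
Qed.

Lemma intRn_ge0 n (F : 'cV[R]_n -> \bar R) : (forall y, 0 <= F y) -> 0 <= intRn F.
Proof. by move=> F0; apply: integral_ge0 => t _. Qed.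

Lemma eq_intRn n (F G : 'cV[R]_n -> \bar R) :
  (forall y, F y = G y) -> intRn F = intRn G.
Proof. by move=> FG; apply: eq_integral => t _. Qed.

Lemma le_intRn n (F G : 'cV[R]_n -> \bar R) : colmeas F -> colmeas G ->
  (forall y, 0 <= F y) -> (forall y, F y <= G y) -> intRn F <= intRn G.
Proof.
move=> mF mG F0 FG; apply: ge0_le_integral => //.
Qed.

Lemma intRnD n (F G : 'cV[R]_n -> \bar R) : colmeas F -> colmeas G ->
  (forall y, 0 <= F y) -> (forall y, 0 <= G y) ->
  intRn (fun y => F y + G y) = intRn F + intRn G.
Proof. by move=> mF mG F0 G0; apply: ge0_integralD. Qed.

Lemma intRnZ n (F : 'cV[R]_n -> \bar R) (c : R) : colmeas F ->
  (forall y, 0 <= F y) -> (0 <= c)%R ->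
  intRn (fun y => c%:E * F y) = c%:E * intRn F.
Proof. by move=> mF F0 c0; apply: ge0_integralZl_EFin. Qed.

Lemma tcol_cons n x (t : n.-tuple T) : tcol [tuple of x :: t] = ccons x (tcol t).
Proof. by apply: cconsP => [|i]; rewrite !mxE !(tnth_nth 0%R). Qed.

Lemma colmeas_tuple_cons n (F : 'cV[R]_n.+1 -> \bar R) : colmeas F ->
  measurable_fun setT (fun p : T * n.-tuple T => F (tcol (tuple_cons p))).
Proof.
move=> mF; apply: (@measurableT_comp _ _ _ _ _ _ (F \o @tcol n.+1)) => //.
exact: measurable_tuple_cons.
Qed.

(** Tonelli for the first coordinate.  It reduces statements on R^n.+1 to a
    one-dimensional integral and induction. *)
Lemma intRn_cons n (F : 'cV[R]_n.+1 -> \bar R) :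
  colmeas F -> (forall y, 0 <= F y) ->
  intRn F = \int[mu]_x intRn (fun y => F (ccons x y)).
Proof.
move=> mF F0.
transitivity (\int[(mu \x lebesgue_tuple R n)%E]_p F (tcol (tuple_cons p))).
  rewrite -[LHS]/(\int[pushforward (mu \x lebesgue_tuple R n)%E (@tuple_cons R n)]_t
    (F \o @tcol n.+1) t).
  rewrite (@ge0_integral_pushforward _ _ _ _ R (@tuple_cons R n)
    (@measurable_tuple_cons R n) (mu \x lebesgue_tuple R n)%E setT) //.
  by move=> y _; exact: F0.
rewrite fubini_tonelli1; [|exact: colmeas_tuple_cons|by move=> ?; exact: F0].
apply: eq_integral => x _; apply: eq_integral => t _.
by rewrite /tuple_cons tcol_cons.
Qed.

Lemma measurable_intRn_sect n (F : 'cV[R]_n.+1 -> \bar R) :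
  colmeas F -> (forall y, 0 <= F y) ->
  measurable_fun setT (fun x : T => intRn (fun y => F (ccons x y))).
Proof.
move=> mF F0.
have := measurable_fun_fubini_tonelli_F (m2 := lebesgue_tuple R n) _
  (colmeas_tuple_cons mF) (fun _ => F0 _).
congr measurable_fun; apply/funext => x.
by apply: eq_integral => t _; rewrite /= /tuple_cons tcol_cons.
Qed.

Lemma intRn_shift n (F : 'cV[R]_n -> \bar R) (b : 'cV[R]_n) :
  colmeas F -> (forall y, 0 <= F y) -> intRn (fun y => F (y + b)%R) = intRn F.
Proof.
elim: n F b => [|n IH] F b mF F0.
  by apply: eq_intRn => y; congr F; rewrite [LHS]flatmx0 [RHS]flatmx0.
rewrite [RHS](intRn_cons mF F0) intRn_cons; [|exact: colmeas_shift|by move=> ?; exact: F0].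
rewrite (ccons_eta b); set b0 := b ord0 0%R; set b1 := \col_i _.
transitivity (\int[mu]_x intRn (fun y => F (ccons (1 * x + b0)%R y))).
  apply: eq_integral => x _; rewrite -[RHS](IH _ b1) //; last exact: colmeas_cons.
  by apply: eq_intRn => y; rewrite cconsD mul1r.
have -> := @lebesgue_integral_affine R 1 b0 (fun x => intRn (fun y => F (ccons x y))).
- by rewrite invr1 mul1e.
- by [].
- exact: measurable_intRn_sect.
- by move=> x; exact: intRn_ge0.
Qed.

Lemma intRn_scale n (F : 'cV[R]_n -> \bar R) (c : R) : (0 < c)%R ->
  colmeas F -> (forall y, 0 <= F y) ->
  intRn (fun y => F (c *: y)%R) = (c ^- n)%:E * intRn F.
Proof.
move=> c0; elim: n F => [|n IH] F mF F0.
  rewrite expr0 invr1 mul1e.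
  by apply: eq_intRn => y; congr F; rewrite [LHS]flatmx0 [RHS]flatmx0.
rewrite [in RHS](intRn_cons mF F0) intRn_cons; [|exact: colmeas_scale|by move=> ?; exact: F0].
have cn0 : (0 <= c ^- n)%R by rewrite invr_ge0 exprn_ge0 // ltW.
transitivity (\int[mu]_x ((c ^- n)%:E * intRn (fun y => F (ccons (c * x + 0)%R y)))).
  apply: eq_integral => x _; rewrite -IH //; last exact: colmeas_cons.
  by apply: eq_intRn => y; rewrite cconsZ addr0.
have mI := measurable_intRn_sect mF F0.
rewrite ge0_integralZl_EFin; last first.
- exact: cn0.
- by apply: (measurableT_comp mI); exact: measurable_affine.
- by move=> x _; exact: intRn_ge0.
- exact: measurableT.
rewrite (@lebesgue_integral_affine R c 0 (fun x => intRn (fun y => F (ccons x y)))) //.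
  by rewrite muleA -EFinM exprSr invfM mulrC.
by move=> x; exact: intRn_ge0.
Qed.

Lemma colmeas_prod n (f : R -> R) : measurable_fun setT f ->
  colmeas (fun y : 'cV[R]_n => \prod_(i < n) f (y i 0%R))%R.
Proof.
move=> mf; rewrite /colmeas.
rewrite (_ : _ \o _ = fun t : n.-tuple T => \prod_(i < n) f (tcol t i 0))%R //.
by apply: measurable_prod => i _; apply: (measurableT_comp mf); exact: measurable_tcol.
Qed.

Lemma intRn_prod n (f : R -> R) (c : R) :
  measurable_fun setT f -> (forall x, (0 <= f x)%R) ->
  \int[mu]_x (f x)%:E = c%:E ->
  intRn (fun y : 'cV[R]_n => (\prod_(i < n) f (y i 0%R))%:E) = (c ^+ n)%:E.
Proof.
move=> mf f0 fc; elim: n => [|n IH].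
  rewrite (@eq_intRn _ _ (cst 1)); last by move=> y; rewrite big_ord0.
  by rewrite /intRn integral_cst // mul1e /= diracT expr0.
have mp k : colmeas (fun y : 'cV[R]_k => (\prod_(i < k) f (y i 0%R))%:E).
  by apply/measurable_EFinP; exact: colmeas_prod.
have p0 k (y : 'cV[R]_k) : 0 <= (\prod_(i < k) f (y i 0%R))%:E.
  by rewrite lee_fin prodr_ge0.
rewrite intRn_cons; [|exact: mp|by move=> y; exact: p0].
transitivity (\int[mu]_x ((f x)%:E * (c ^+ n)%:E)).
  apply: eq_integral => x _; rewrite -IH -intRnZ; [|exact: mp|by move=> y; exact: p0|exact: f0].
  apply: eq_intRn => y; rewrite -EFinM big_ord_recl; congr (_ * _)%:E.
    by rewrite ccons0.
  by apply: eq_bigr => i _; rewrite cconsS.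
rewrite ge0_integralZr; [|exact: measurableT| | |]; last 3 first.
- exact/measurable_EFinP.
- by move=> x _; rewrite lee_fin.
- by rewrite lee_fin exprn_ge0 // -lee_fin -fc integral_ge0 // => x _; rewrite lee_fin.
by rewrite fc -EFinM exprS.
Qed.

(** Both sides are the double integral of [f (O x) g (y + O x)].  Integrating
    first in [y] gives the left-hand side; substituting [x - O^-1 y] for [x] and
    exchanging the order of integration gives the right-hand side.  Only
    translations are used, so the identity is available before any linear
    change of variables is. *)
Lemma intRn_mulmx_conv n (O : 'M[R]_n) (f g : 'cV[R]_n -> \bar R) :
  (O *m O^T = 1%:M)%R -> colmeas f -> colmeas g ->
  (forall y, 0 <= f y) -> (forall y, 0 <= g y) ->
  intRn (fun x => f (O *m x)%R) * intRn g =
  intRn (fun y => f (- y)%R) * intRn (fun x => g (O *m x)%R).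
Proof.
move=> OO mf mg f0 g0.
have mtO := @colmeas_mulmx n n _ _ ^~ O.
have mO (X : measurableType _) (h : X -> n.-tuple T) i : measurable_fun setT h ->
    measurable_fun setT (fun x => (O *m tcol (h x))%R i 0%R).
  move=> mh; apply: measurable_mulmx => j.
  by apply: (measurableT_comp (measurable_tcol j)).
have mt (X : measurableType _) (h : X -> n.-tuple T) i : measurable_fun setT h ->
    measurable_fun setT (fun x => tcol (h x) i 0%R).
  by move=> mh; apply: (measurableT_comp (measurable_tcol i)).
transitivity (intRn (fun x => intRn (fun y => f (O *m x)%R * g (y + O *m x)%R))).
  rewrite /intRn -ge0_integralZr; [|exact: measurableT| | |]; last 3 first.
  - exact: mtO.
  - by move=> x _; exact: f0.
  - exact: intRn_ge0.
  apply: eq_integral => x _.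
  rewrite ge0_integralZl; [|exact: measurableT| | |]; last 3 first.
  - exact: colmeas_shift.
  - by move=> y _; exact: g0.
  - exact: f0.
  by congr (_ * _); apply/esym/intRn_shift.
transitivity (intRn (fun y => intRn (fun x => f (O *m x)%R * g (y + O *m x)%R))).
  rewrite /intRn (fubini_tonelli (m1 := lebesgue_tuple R n) (m2 := lebesgue_tuple R n)
    (fun p => f (O *m tcol p.1)%R * g (tcol p.2 + O *m tcol p.1)%R)).
  - by [].
  - apply: emeasurable_funM.
      by apply: (colmeas_comp mf) => i; exact: mO.
    apply: (colmeas_comp mg) => i.
    rewrite (_ : (fun _ => _) = fun p : n.-tuple T * n.-tuple T =>
      (tcol p.2 i 0 + (O *m tcol p.1) i 0)%R).
      by apply: measurable_funD; [exact: mt|exact: mO].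
    by apply/funext => p; rewrite [LHS]mxE.
  - by move=> p; rewrite mule_ge0.
transitivity (intRn (fun y => intRn (fun x => f (O *m x - y)%R * g (O *m x)%R))).
  apply: eq_intRn => y.
  rewrite -(@intRn_shift _ _ (- (O^T *m y))%R).
  - apply: eq_intRn => x.
    by rewrite mulmxDr mulmxN mulmxA OO mul1mx (addrC y) subrK.
  - rewrite /colmeas; apply: emeasurable_funM; first exact: mtO.
    have := colmeas_affine O y mg; rewrite /colmeas; congr (measurable_fun _ _).
    by apply/funext => x; rewrite addrC.
  - by move=> x; rewrite mule_ge0.
transitivity (intRn (fun x => intRn (fun y => f (O *m x - y)%R * g (O *m x)%R))).
  rewrite /intRn (fubini_tonelli (m1 := lebesgue_tuple R n) (m2 := lebesgue_tuple R n)
    (fun p => f (O *m tcol p.2 - tcol p.1)%R * g (O *m tcol p.2)%R)).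
  - by [].
  - apply: emeasurable_funM.
      apply: (colmeas_comp mf) => i.
      rewrite (_ : (fun _ => _) = fun p : n.-tuple T * n.-tuple T =>
        ((O *m tcol p.2) i 0 - tcol p.1 i 0)%R).
        by apply: measurable_funB; [exact: mO|exact: mt].
      by apply/funext => p; rewrite !mxE.
    by apply: (colmeas_comp mg) => i; exact: mO.
  - by move=> p; rewrite mule_ge0.
have mfN : colmeas (fun y => f (- y)%R).
  have := colmeas_scale (- 1)%R mf; congr colmeas.
  by apply/funext => x; rewrite scaleN1r.
rewrite {1 3}/intRn -ge0_integralZl; [|exact: measurableT| | |]; last 3 first.
- exact: mtO.
- by move=> x _; exact: g0.
- by apply: integral_ge0 => t _; exact: f0.
apply: eq_integral => x _.
rewrite -[X in _ = X * _]/(intRn (fun y => f (- y)%R)) -(intRn_shift (- (O *m tcol x))%R mfN) //.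
rewrite /intRn -ge0_integralZr; [|exact: measurableT| | |]; last 3 first.
- exact: (colmeas_shift (- (O *m tcol x))%R mfN).
- by move=> y _; exact: f0.
- exact: g0.
by apply: eq_integral => y _; rewrite opprD opprK addrC.
Qed.

Definition unit_ball n (y : 'cV[R]_n) : R := ((enorm y <= 1)%R)%:R.

Lemma unit_ball_ge0 n (y : 'cV[R]_n) : (0 <= unit_ball y)%R.
Proof. exact: ler0n. Qed.

Lemma colmeas_enorm n : colmeas (@enorm R n).
Proof.
apply: (@measurableT_comp _ _ _ _ _ _ (@Num.sqrt R)) => //.
  exact: (continuous_measurable_fun (@sqrt_continuous R)).
by apply: measurable_sum => i; apply: measurable_funX; exact: measurable_tcol.
Qed.

Lemma measurable_indic_le (a : R) : measurable_fun setT (fun r : R => (r <= a)%R%:R : R).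
Proof.
rewrite (_ : (fun _ => _) = \1_(`]-oo, a]%classic) :> (R -> R)); last first.
  by apply/funext => r; rewrite indicE mem_setE in_itv.
exact: measurable_indic.
Qed.

Lemma colmeas_unit_ball n : colmeas (@unit_ball n).
Proof.
exact: (measurableT_comp (measurable_indic_le 1) (@colmeas_enorm n)).
Qed.

Lemma enorm_ge0 n (y : 'cV[R]_n) : (0 <= enorm y)%R.
Proof. exact: sqrtr_ge0. Qed.

Lemma enorm_sqr n (y : 'cV[R]_n) : (enorm y ^+ 2 = \sum_i y i 0 ^+ 2)%R.
Proof. by rewrite sqr_sqrtr // sumr_ge0 // => i _; rewrite sqr_ge0. Qed.

Lemma le1_enorm n (y : 'cV[R]_n) : (enorm y <= 1)%R = (\sum_i y i 0 ^+ 2 <= 1)%R.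
Proof. by rewrite -enorm_sqr expr_le1 // enorm_ge0. Qed.

Lemma coord_le_enorm n (y : 'cV[R]_n) i : (`|y i 0| <= enorm y)%R.
Proof.
rewrite -(@ler_pXn2r _ 2) ?nnegrE ?enorm_ge0 // enorm_sqr real_normK ?num_real //.
by rewrite (bigD1 i) //= lerDl sumr_ge0 // => j _; rewrite sqr_ge0.
Qed.

Definition box n (a b : R) (y : 'cV[R]_n) : R :=
  (\prod_(i < n) \1_(`[a, b]%classic) (y i 0))%R.

Lemma box_ge0 n a b (y : 'cV[R]_n) : (0 <= box a b y)%R.
Proof. by apply: prodr_ge0. Qed.

Lemma colmeas_box n a b : colmeas (@box n a b).
Proof. by apply: colmeas_prod; exact: measurable_indic. Qed.

Lemma intRn_box n a b : (a <= b)%R ->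
  intRn (fun y : 'cV[R]_n => (box a b y)%:E) = ((b - a) ^+ n)%:E.
Proof.
move=> ab; apply: intRn_prod; [exact: measurable_indic|by move=> x; rewrite indicE|].
rewrite integral_indic // setIT [LHS]lebesgue_measure_itv /= lte_fin.
by case: ltP => ba; rewrite -?EFinB //; congr EFin; lra.
Qed.

Lemma boxP n a b (y : 'cV[R]_n) :
  box a b y = ([forall i, (a <= y i 0 <= b)%R])%:R%R.
Proof.
rewrite /box; case: forallP => [h|/forallP].
  rewrite big1 // => i _; rewrite indicE mem_set //.
  by rewrite /= in_itv /= h.
rewrite negb_forall => /existsP[i /negbTE h].
by rewrite (bigD1 i) //= indicE mem_setE in_itv /= h mul0r.
Qed.

Lemma unit_ball_le_box n (y : 'cV[R]_n) : (unit_ball y <= box (-1) 1 y)%R.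
Proof.
rewrite boxP /unit_ball; have [y1|_] := leP (enorm y) 1%R; last exact: ler0n.
case: forallP => // -[] i; rewrite -ler_norml.
exact: le_trans (coord_le_enorm _ _) y1.
Qed.

Lemma box_le_unit_ball n (y : 'cV[R]_n) (a : R) :
  (0 <= a)%R -> (n%:R * (2 * a) ^+ 2 <= 1)%R -> (box a (2 * a) y <= unit_ball y)%R.
Proof.
move=> a0 na; rewrite boxP; case: forallP => [h|_]; last exact: unit_ball_ge0.
rewrite /unit_ball le1_enorm (le_trans _ na) //.
rewrite -[n in n%:R]card_ord -sum1_card natr_sum mulr_suml ler_sum // => i _.
have /andP[l u] := h i; rewrite mul1r ler_pXn2r ?nnegrE //.
  exact: le_trans l.
by rewrite mulr_ge0.
Qed.

Lemma intRn_unit_ball_fin n : intRn (fun y : 'cV[R]_n => (unit_ball y)%:E) \is a fin_num.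
Proof.
rewrite ge0_fin_numE; last first.
  by apply: intRn_ge0 => y; rewrite lee_fin unit_ball_ge0.
apply: (@le_lt_trans _ _ (intRn (fun y : 'cV[R]_n => (box (-1) 1 y)%:E))).
  apply: le_intRn.
  - by apply: colmeas_EFin; exact: colmeas_unit_ball.
  - by apply: colmeas_EFin; exact: colmeas_box.
  - by move=> y; rewrite lee_fin unit_ball_ge0.
  - by move=> y; rewrite lee_fin unit_ball_le_box.
by rewrite intRn_box ?ltry // lerNl opprK; lra.
Qed.

(** A corner box with this side has positive volume and lies in the unit ball,
    away from the coordinate hyperplanes; it makes integrals over the ball
    visibly positive. *)
Definition box_side n : R := (2 * n.+1%:R)^-1%R.

Lemma box_side_gt0 n : (0 < box_side n)%R.
Proof. by rewrite invr_gt0 mulr_gt0. Qed.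

Lemma box_side_le n : (n.+1%:R * (2 * box_side n) ^+ 2 <= 1)%R.
Proof.
rewrite (_ : 2 * box_side n = (n.+1%:R)^-1)%R; last first.
  by rewrite /box_side invfM mulrA mulfV ?mul1r ?pnatr_eq0.
by rewrite expr2 mulrA mulfV ?pnatr_eq0 // mul1r invf_le1 ?ler1n.
Qed.

Lemma intRn_small_box n :
  0 < intRn (fun y : 'cV[R]_n.+1 => (box (box_side n) (2 * box_side n) y)%:E).
Proof.
have b0 := box_side_gt0 n.
by rewrite intRn_box ?lte_fin ?exprn_gt0 //; lra.
Qed.

Lemma intRn_unit_ball_gt0 n : 0 < intRn (fun y : 'cV[R]_n.+1 => (unit_ball y)%:E).
Proof.
apply: (lt_le_trans (intRn_small_box n)); apply: le_intRn.
- by apply: colmeas_EFin; exact: colmeas_box.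
- by apply: colmeas_EFin; exact: colmeas_unit_ball.
- by move=> y; rewrite lee_fin box_ge0.
- move=> y; rewrite lee_fin box_le_unit_ball ?box_side_le //.
  exact/ltW/box_side_gt0.
Qed.

Lemma enorm_dot n (y : 'cV[R]_n) : (enorm y ^+ 2 = (y^T *m y) 0 0)%R.
Proof.
by rewrite enorm_sqr mxE; apply: eq_bigr => i _; rewrite mxE expr2.
Qed.

Lemma enorm_mulmx n (O : 'M[R]_n) (y : 'cV[R]_n) :
  (O^T *m O = 1%:M)%R -> enorm (O *m y)%R = enorm y.
Proof.
move=> OO; apply/eqP; rewrite -(@eqrXn2 _ 2) ?enorm_ge0 // !enorm_dot.
by rewrite trmx_mul mulmxA -(mulmxA _ _ O) OO mulmx1.
Qed.

(** In [intRn_mulmx_conv] take for [g] the indicator of the unit ball.  It is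
    unchanged by an orthogonal [O], so the right-hand side does not depend on
    [O] and can be compared with the case of the identity; the volume of the
    ball, finite and positive, cancels. *)
Lemma intRn_mulmx_orth n (O : 'M[R]_n.+1) (f : 'cV[R]_n.+1 -> \bar R) :
  (O^T *m O = 1%:M)%R -> colmeas f -> (forall y, 0 <= f y) ->
  intRn (fun x => f (O *m x)%R) = intRn f.
Proof.
move=> OO mf f0; set g := fun y : 'cV[R]_n.+1 => (unit_ball y)%:E.
have mg : colmeas g by apply: colmeas_EFin; exact: colmeas_unit_ball.
have g0 y : 0 <= g y by rewrite lee_fin unit_ball_ge0.
have conv (P : 'M[R]_n.+1) : (P^T *m P = 1%:M)%R ->
    intRn (fun x => f (P *m x)%R) * intRn g = intRn (fun y => f (- y)%R) * intRn g.
  move=> PP; rewrite (@intRn_mulmx_conv _ P f g _ mf mg f0 g0); last exact: mulmx1C.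
  by congr (_ * _); apply: eq_intRn => x; rewrite /g /unit_ball enorm_mulmx.
have gfin := intRn_unit_ball_fin n.+1; have ggt0 := intRn_unit_ball_gt0 n.
have : intRn (fun x => f (O *m x)%R) * intRn g = intRn f * intRn g.
  rewrite conv // -[in LHS](conv 1%:M); last by rewrite trmx1 mulmx1.
  by congr (_ * _); apply: eq_intRn => x; rewrite mul1mx.
rewrite -/g in gfin ggt0; rewrite -(fineK gfin).
move/(congr1 (fun z => z * ((fine (intRn g))^-1)%:E)).
by rewrite -!muleA -EFinM divff ?mule1 // gt_eqF // fine_gt0 // ggt0 ltey_eq gfin.
Qed.

(** For a fixed first coordinate a shear is a translation of the others. *)
Lemma intRn_shear n (F : 'cV[R]_n.+1 -> \bar R) (q : 'cV[R]_n.+1) :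
  colmeas F -> (forall y, 0 <= F y) -> q ord0 0%R = 0%R ->
  intRn (fun y => F (y + y ord0 0 *: q)%R) = intRn F.
Proof.
move=> mF F0 q0.
rewrite [RHS](intRn_cons mF F0) intRn_cons; last first.
- by move=> y; exact: F0.
- apply: (colmeas_comp mF) => i.
  rewrite (_ : (fun _ => _) = fun t : n.+1.-tuple T =>
    (tcol t i 0 + tcol t ord0 0 * q i 0)%R).
    apply: measurable_funD; first exact: measurable_tcol.
    by apply: measurable_funM => //; exact: measurable_tcol.
  by apply/funext => t; rewrite !mxE.
apply: eq_integral => x _.
rewrite -[RHS](@intRn_shift _ _ (\col_i (x * q (lift ord0 i) 0)%R)).
- apply: eq_intRn => y; rewrite ccons0; congr F; apply: cconsP => [|i].
    by rewrite mxE ccons0 mxE q0 mulr0 addr0.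
  by rewrite mxE cconsS !mxE.
- exact: colmeas_cons.
- by move=> y; exact: F0.
Qed.

End column_integral.

(** * Symmetric matrices *)

Section symmetric_matrices.
Context {R : realType}.

Definition dot n (x y : 'cV[R]_n) : R := \sum_i x i 0 * y i 0.

Lemma dotE n (x y : 'cV[R]_n) : (x^T *m y) 0 0 = dot x y.
Proof. by rewrite mxE; apply: eq_bigr => i _; rewrite mxE. Qed.

Lemma dotmxE n (x y : 'cV[R]_n) : x^T *m y = (dot x y)%:M.
Proof. by rewrite [LHS]mx11_scalar dotE. Qed.

Lemma dotC n (x y : 'cV[R]_n) : dot x y = dot y x.
Proof. by apply: eq_bigr => i _; rewrite mulrC. Qed.

Lemma dotDr n (x y z : 'cV[R]_n) : dot x (y + z) = dot x y + dot x z.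
Proof. by rewrite -!dotE mulmxDr mxE. Qed.

Lemma dotZr n (x y : 'cV[R]_n) a : dot x (a *: y) = a * dot x y.
Proof. by rewrite -!dotE -scalemxAr mxE. Qed.

Lemma dotDl n (x y z : 'cV[R]_n) : dot (y + z) x = dot y x + dot z x.
Proof. by rewrite !(dotC _ x) dotDr. Qed.

Lemma dotZl n (x y : 'cV[R]_n) a : dot (a *: y) x = a * dot y x.
Proof. by rewrite !(dotC _ x) dotZr. Qed.

Lemma dotNr n (x y : 'cV[R]_n) : dot x (- y) = - dot x y.
Proof. by rewrite -scaleN1r dotZr mulN1r. Qed.

Lemma dotNl n (x y : 'cV[R]_n) : dot (- y) x = - dot y x.
Proof. by rewrite !(dotC _ x) dotNr. Qed.

Lemma dot_mulmxl m n (A : 'M[R]_(m, n)) x y : dot (A *m x) y = dot x (A^T *m y).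
Proof. by rewrite -!dotE trmx_mul mulmxA. Qed.

Lemma dot_sum_sqr n (x : 'cV[R]_n) : dot x x = \sum_i x i 0 ^+ 2.
Proof. by apply: eq_bigr => i _; rewrite expr2. Qed.

Lemma dot_ge0 n (x : 'cV[R]_n) : 0 <= dot x x.
Proof. by rewrite dot_sum_sqr sumr_ge0 // => i _; rewrite sqr_ge0. Qed.

Lemma dot_eq0 n (x : 'cV[R]_n) : (dot x x == 0) = (x == 0).
Proof.
rewrite dot_sum_sqr psumr_eq0; last by move=> i _; rewrite sqr_ge0.
apply/allP/eqP => [h|-> i _ /=]; last by rewrite mxE expr0n eqxx.
by apply/colP => i; apply/eqP; rewrite mxE -sqrf_eq0; apply: (h i); rewrite mem_index_enum.
Qed.

Lemma dot_gt0 n (x : 'cV[R]_n) : (0 < dot x x) = (x != 0).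
Proof. by rewrite lt_neqAle dot_ge0 andbT eq_sym dot_eq0. Qed.

Lemma dot_delta n (i : 'I_n) (y : 'cV[R]_n) : dot (delta_mx i 0) y = y i 0.
Proof.
rewrite /dot (bigD1 i) //= !mxE !eqxx mul1r big1 ?addr0 // => j ji.
by rewrite mxE (negbTE ji) mul0r.
Qed.

Definition evec n : 'cV[R]_n.+1 := delta_mx ord0 0.

Lemma dot_evec n (x : 'cV[R]_n.+1) : dot (evec n) x = x ord0 0.
Proof. exact: dot_delta. Qed.

Lemma evec_norm n : dot (evec n) (evec n) = 1.
Proof. by rewrite dot_evec mxE !eqxx. Qed.

(** The Householder reflection in the hyperplane orthogonal to [e - f]
    exchanges [e] and [f]. *)
Lemma reflection_evec n (f : 'cV[R]_n.+1) : dot f f = 1 ->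
  exists H : 'M[R]_n.+1, [/\ H^T = H, H *m H = 1%:M & H *m evec n = f].
Proof.
move=> ff; have [->|fe] := eqVneq f (evec n).
  by exists 1%:M; rewrite trmx1 !mul1mx.
pose w := evec n - f.
have w0 : w != 0 by rewrite subr_eq0 eq_sym.
have ww0 : dot w w != 0 by rewrite dot_eq0.
pose c := 2 / dot w w.
pose H : 'M[R]_n.+1 := 1%:M - c *: (w *m w^T).
have He x : H *m x = x - (c * dot w x) *: w.
  rewrite mulmxBl mul1mx -scalemxAl -mulmxA dotmxE mul_mx_scalar.
  by rewrite scalerA.
exists H; split.
- by rewrite /H linearB /= linearZ /= trmx_mul trmxK trmx1.
- rewrite {2}/H mulmxBr mulmx1 -scalemxAr mulmxA He.
  rewrite mulmxBl -scalemxAl -/H {1}/H scalerBr scalerA opprB addrA.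
  have -> : c * (c * dot w w) = 2 * c by rewrite /c; field.
  rewrite (_ : 2 * c = c + c) ?scalerDl; last by ring.
  by move: (c *: _) => X; rewrite addrA subrK addrK.
rewrite He.
have W : dot w w = 2 * dot w (evec n).
  rewrite /w !dotDl !dotDr !dotNl !dotNr ff evec_norm (dotC f).
  ring.
have -> : c * dot w (evec n) = 1 by rewrite /c mulrAC -W mulfV.
by rewrite scale1r /w opprB addrC subrK.
Qed.

Lemma char_poly_conj n (A H : 'M[R]_n) : H *m H = 1%:M ->
  char_poly (H *m A *m H) = char_poly A.
Proof.
move=> HH; rewrite /char_poly.
pose Hp := map_mx polyC H.
have HpHp : Hp *m Hp = 1%:M by rewrite /Hp -map_mxM HH map_scalar_mx.
have -> : char_poly_mx (H *m A *m H) = Hp *m char_poly_mx A *m Hp.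
  rewrite /char_poly_mx !map_mxM mulmxBr mulmxBl; congr (_ - _).
  by rewrite scalar_mxC -mulmxA HpHp mulmx1.
by rewrite !det_mulmx mulrC mulrA -det_mulmx HpHp det1 mul1r.
Qed.

Lemma char_poly_cons n (a : R) (A : 'M[R]_n) :
  char_poly (block_mx a%:M 0 0 A : 'M[R]_(1 + n)) = ('X - a%:P) * char_poly A.
Proof.
rewrite /char_poly /char_poly_mx (map_block_mx _ a%:M) !map_mx0 map_scalar_mx.
rewrite (scalar_mx_block 1 n) opp_block_mx add_block_mx !oppr0 !addr0 det_ublock.
by rewrite -raddfB /= det_scalar1.
Qed.

(** Induction by deflation: a reflection moves a unit eigenvector to the first
    basis vector, and symmetry makes the conjugate matrix block diagonal.  Its
    characteristic polynomial factors accordingly, so the remaining entries of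
    [lam] list the eigenvalues of the lower block. *)
Theorem spectral n (A : 'M[R]_n) (lam : 'I_n -> R) : A^T = A ->
  eigenvalues_of A lam ->
  exists P : 'M[R]_n, P^T *m P = 1%:M /\ P *m A *m P^T = diag_mx (\row_i lam i).
Proof.
elim: n A lam => [|n IH] A lam AT Alam.
  by exists 0; rewrite [LHS]flatmx0; split; [exact/esym/flatmx0|rewrite [LHS]flatmx0 [RHS]flatmx0].
have : eigenvalue A (lam ord0).
  rewrite eigenvalue_root_char Alam /root horner_prod prodf_seq_eq0.
  by apply/hasP; exists ord0; rewrite ?mem_index_enum //= hornerXsubC subrr.
move=> /eigenvalueP[v vA v0].
pose x := v^T.
have Ax : A *m x = lam ord0 *: x by rewrite /x -{1}AT -trmx_mul vA linearZ.
have x0 : x != 0 by rewrite /x trmx_eq0.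
pose f := (Num.sqrt (dot x x))^-1 *: x.
have ff : dot f f = 1.
  rewrite dotZl dotZr mulrA -invfM -expr2 sqr_sqrtr ?dot_ge0 //.
  by rewrite mulVf // dot_eq0.
have Af : A *m f = lam ord0 *: f by rewrite /f -scalemxAr Ax !scalerA mulrC.
have [H [HT HH Hf]] := reflection_evec ff.
have [B BE0] : exists B : 'M[R]_(1 + n), B = H *m A *m H by exists (H *m A *m H).
have BT : B^T = B by rewrite BE0 !trmx_mul HT AT mulmxA.
have Be : B *m evec n = lam ord0 *: evec n.
  rewrite BE0 -!mulmxA Hf Af -scalemxAr; congr (_ *: _).
  by rewrite -Hf mulmxA HH mul1mx.
have Bcol i : B i ord0 = lam ord0 *+ (i == ord0).
  have h : (B *m evec n) i 0 = B i ord0 by rewrite -colE mxE.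
  by rewrite -h Be mxE [evec n i 0]mxE eqxx andbT mulr_natr.
pose A' := drsubmx B.
have BE : B = block_mx (lam ord0)%:M 0 0 A'.
  rewrite -[LHS](@submxK _ 1 n 1 n); congr block_mx.
  - apply/matrixP => i j; rewrite !ord1 !mxE eqxx mulr1n.
    by rewrite (_ : lshift n 0 = ord0 :> 'I_(1 + n)) ?Bcol ?eqxx //; exact/val_inj.
  - apply/matrixP => i j; rewrite !ord1 !mxE -BT mxE.
    by rewrite (_ : lshift n 0 = ord0 :> 'I_(1 + n)) ?Bcol //; exact/val_inj.
  - apply/matrixP => i j; rewrite !ord1 !mxE.
    by rewrite (_ : lshift n 0 = ord0 :> 'I_(1 + n)) ?Bcol //; exact/val_inj.
have A'T : A'^T = A' by rewrite /A' -[in RHS]BT trmx_drsub.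
have A'lam : eigenvalues_of A' (fun i => lam (lift ord0 i)).
  rewrite /eigenvalues_of; apply: (@mulfI _ ('X - (lam ord0)%:P)).
    by rewrite polyXsubC_eq0.
  rewrite -char_poly_cons -BE BE0 char_poly_conj // Alam.
  exact: big_ord_recl.
have [P' [P'P P'A]] := IH A' _ A'T A'lam.
pose P : 'M[R]_(1 + n) := block_mx 1%:M 0 0 P'.
have PP : P^T *m P = 1%:M.
  rewrite /P tr_block_mx !trmx0 trmx1 mulmx_block !mulmx0 !mul0mx !addr0 !add0r.
  by rewrite mulmx1 P'P -scalar_mx_block.
exists (P *m H); split.
  by rewrite trmx_mul mulmxA -(mulmxA _ _ P) PP mulmx1 HT HH.
have -> : P *m H *m A *m (P *m H)^T = P *m B *m P^T.
  by rewrite trmx_mul HT BE0 !mulmxA.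
rewrite BE /P tr_block_mx !trmx0 trmx1 !mulmx_block !mulmx0 !mul0mx !addr0 !add0r.
rewrite !mulmx1 mul1mx P'A.
rewrite mul0mx; apply/matrixP => i j.
case: (@split_ordP 1 n i) => i' ->; case: (@split_ordP 1 n j) => j' ->.
- apply: etrans (block_mxEul _ _ _ _ _ _) _.
  rewrite !ord1 mxE [RHS]mxE [in RHS]mxE !eqxx; congr (lam _ *+ _).
  exact/val_inj.
- apply: etrans (block_mxEur _ _ _ _ _ _) _.
  by rewrite ord1 mxE [RHS]mxE -val_eqE.
- apply: etrans (block_mxEdl _ _ _ _ _ _) _.
  by rewrite ord1 mxE [RHS]mxE -val_eqE.
- apply: etrans (block_mxEdr _ _ _ _ _ _) _.
  rewrite mxE [RHS]mxE ![in LHS]mxE ![in RHS]mxE -!val_eqE /= eqn_add2l.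
  by congr (lam _ *+ _); exact/val_inj.
Qed.

Lemma cauchy_schwarz (I : finType) (P : pred I) (x y : I -> R) :
  (\sum_(i | P i) x i * y i) ^+ 2 <=
  (\sum_(i | P i) x i ^+ 2) * (\sum_(i | P i) y i ^+ 2).
Proof.
set A := \sum_(i | P i) x i ^+ 2; set B := \sum_(i | P i) y i ^+ 2.
set C := \sum_(i | P i) x i * y i.
have B0 : 0 <= B by apply: sumr_ge0 => i _; exact: sqr_ge0.
have [B00|Bn0] := eqVneq B 0.
  rewrite /C big1 ?expr0n ?B00 ?mulr0 // => i Pi.
  have /eqP : B = 0 by [].
  rewrite psumr_eq0; last by move=> j _; exact: sqr_ge0.
  by move/allP => /(_ i (mem_index_enum _)); rewrite Pi /= sqrf_eq0 => /eqP ->; rewrite mulr0.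
have : 0 <= \sum_(i | P i) (B * x i - C * y i) ^+ 2.
  by apply: sumr_ge0 => i _; exact: sqr_ge0.
rewrite (eq_bigr (fun i => B ^+ 2 * x i ^+ 2 - 2 * B * C * (x i * y i) + C ^+ 2 * y i ^+ 2));
  last by move=> i _; ring.
rewrite big_split /= sumrB -!mulr_sumr -/A -/B -/C.
have -> : B ^+ 2 * A - 2 * B * C * C + C ^+ 2 * B = B * (A * B - C ^+ 2) by ring.
by rewrite pmulr_rge0 ?subr_ge0 // lt_neqAle eq_sym Bn0.
Qed.

(** The inequality |A e| |A z| >= |e| |z| for [z] orthogonal to [A e], in an
    eigenbasis of [A].  It is clear if all [lam i ^+ 2] are at least 1.
    Otherwise exactly one of them, [c = lam k ^+ 2], is below 1 and the others
    are at least [1 / c].  The orthogonality relation expresses the [k]-th term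
    through the others, so Cauchy-Schwarz bounds [c e_k^2 z_k^2] by
    sum_(i != k) e_i^2 times sum_(i != k) (lam_i z_i)^2, which makes up for the
    loss in the direction [k]. *)
Lemma weighted_orth_le n (lam e z : 'I_n -> R) : (1 < n)%N ->
  (forall i j, i != j -> 1 <= lam i ^+ 2 * lam j ^+ 2) ->
  \sum_i lam i * (e i * z i) = 0 ->
  (\sum_i e i ^+ 2) * (\sum_i z i ^+ 2) <=
  (\sum_i (lam i * e i) ^+ 2) * (\sum_i (lam i * z i) ^+ 2).
Proof.
move=> n1 lam1 ez.
have s0 (f : 'I_n -> R) (P : pred 'I_n) : 0 <= \sum_(i | P i) f i ^+ 2.
  by apply: sumr_ge0 => i _; exact: sqr_ge0.
have [/forallP all1|] := boolP [forall i, 1 <= lam i ^+ 2].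
  have H (f : 'I_n -> R) : \sum_i f i ^+ 2 <= \sum_i (lam i * f i) ^+ 2.
    by apply: ler_sum => i _; rewrite exprMn ler_peMl ?sqr_ge0.
  exact: ler_pM.
rewrite negb_forall => /existsP[k]; rewrite -ltNge => ck1.
have [j jk] : exists j, j != k.
  have [k0|k0] := eqVneq k (Ordinal n1); last by exists (Ordinal n1); rewrite eq_sym.
  by exists (Ordinal (ltnW n1)); rewrite k0.
have c0 : 0 < lam k ^+ 2.
  rewrite lt_neqAle sqr_ge0 andbT eq_sym; apply/eqP => h.
  by have := lam1 j k jk; rewrite h mulr0 ler10.
set c := lam k ^+ 2 in ck1 c0.
have D f : \sum_i f i = f k + \sum_(i | i != k) f i :> R by exact: bigD1.
rewrite (D (fun i => e i ^+ 2)) (D (fun i => z i ^+ 2)).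
rewrite (D (fun i => (lam i * e i) ^+ 2)) (D (fun i => (lam i * z i) ^+ 2)).
set E := \sum_(i | i != k) e i ^+ 2; set Z := \sum_(i | i != k) z i ^+ 2.
set Y := \sum_(i | i != k) (lam i * e i) ^+ 2.
set X := \sum_(i | i != k) (lam i * z i) ^+ 2.
have ZX : Z <= c * X.
  rewrite mulr_sumr; apply: ler_sum => i ik.
  by rewrite exprMn mulrA ler_peMl ?sqr_ge0 // mulrC lam1.
have EY : E <= c * Y.
  rewrite mulr_sumr; apply: ler_sum => i ik.
  by rewrite exprMn mulrA ler_peMl ?sqr_ge0 // mulrC lam1.
have CS : c * (e k ^+ 2 * z k ^+ 2) <= E * X.
  apply: le_trans (cauchy_schwarz _ _ _).
  have -> : \sum_(i | i != k) e i * (lam i * z i) = - (lam k * (e k * z k)).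
    apply/eqP; rewrite -subr_eq0 opprK; apply/eqP; rewrite -[RHS]ez [RHS](bigD1 k) //= addrC.
    by congr (_ + _); apply: eq_bigr => i _; ring.
  by rewrite sqrrN !exprMn.
have [E0 Z0 X0 Y0] : [/\ 0 <= E, 0 <= Z, 0 <= X & 0 <= Y] by split; exact: s0.
rewrite !exprMn -/c.
set a := e k ^+ 2 in CS *; set b := z k ^+ 2 in CS *.
have [a0 b0] : 0 <= a /\ 0 <= b by split; exact: sqr_ge0.
apply: (@le_trans _ _ ((a + E) * (b + c * X))).
  by apply: ler_wpM2l; [exact: addr_ge0|rewrite lerD2l].
(* The middle term exceeds c times the current left-hand side by (1 - c^2)
   times the Cauchy-Schwarz defect, and E <= c Y gives the rest. *)
rewrite -(ler_pM2l c0).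
apply: (@le_trans _ _ ((c * (c * a) + E) * (c * b + X))).
  rewrite -subr_ge0.
  have -> : (c * (c * a) + E) * (c * b + X) - c * ((a + E) * (b + c * X)) =
    (1 - c ^+ 2) * (E * X - c * (a * b)) by ring.
  apply: mulr_ge0; rewrite subr_ge0 //.
  by rewrite expr_le1 // ltW.
rewrite [leRHS]mulrA; apply: ler_wpM2r.
  by apply: addr_ge0 => //; apply: mulr_ge0 => //; exact: ltW.
by rewrite mulrDr lerD2l.
Qed.

Lemma sigma2E n (zeta : 'I_n -> R) :
  2 * sigma2 zeta = (\sum_i zeta i) ^+ 2 - \sum_i zeta i ^+ 2.
Proof.
have -> : (\sum_i zeta i) ^+ 2 = \sum_i \sum_j zeta i * zeta j.
  by rewrite expr2 mulr_suml; apply: eq_bigr => i _; rewrite mulr_sumr.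
have -> : \sum_i \sum_j zeta i * zeta j =
    \sum_(i < n) (\sum_(j < n | (i < j)%N) zeta i * zeta j +
      \sum_(j < n | (j < i)%N) zeta i * zeta j + zeta i ^+ 2).
  apply: eq_bigr => i _; rewrite (bigD1 i) //= -expr2 addrC; congr (_ + _).
  rewrite (bigID (fun j : 'I_n => (i < j)%N)) /=; congr (_ + _); apply: eq_bigl => j.
    by rewrite andb_idl // => ij; rewrite -val_eqE /= gtn_eqF.
  by rewrite -val_eqE /= -leqNgt ltn_neqAle.
rewrite !big_split /= addrK mulr_natl mulr2n /sigma2; congr (_ + _).
rewrite (exchange_big_dep predT) //=; apply: eq_bigr => i _.
by apply: eq_bigr => j _; rewrite mulrC.
Qed.

(** With [s] the sum of the [zeta] one has [lam i ^+ 2 = s - zeta i] and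
    [s^2 = 2 + sum zeta^2 >= 2 + zeta_i^2 + zeta_j^2], so that
    2 ((s - zeta_i) (s - zeta_j) - 1) >= (s - zeta_i - zeta_j)^2 >= 0. *)
Lemma A2_eigenvalues_prod n (lam zeta : 'I_n -> R) i j : sigma2 zeta = 1 ->
  (forall i, lam i ^+ 2 = \sum_(j < n | j != i) zeta j) -> i != j ->
  1 <= lam i ^+ 2 * lam j ^+ 2.
Proof.
move=> s2 lamE ij.
have := sigma2E zeta; rewrite s2 mulr1; set s := \sum_i _; set q := \sum_i _ => sq.
have lamE' k : lam k ^+ 2 = s - zeta k.
  by rewrite lamE /s [in RHS](bigD1 k) //= addrAC subrr add0r.
have : zeta i ^+ 2 + zeta j ^+ 2 <= q.
  rewrite /q (bigD1 i) //= (bigD1 j) 1?eq_sym //= addrA lerDl.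
  by apply: sumr_ge0 => k _; exact: sqr_ge0.
rewrite !lamE' => qle.
have := sqr_ge0 (s - zeta i - zeta j).
nra.
Qed.

(** For this class the degeneration of [A] is limited: what [A] contracts in
    one direction it expands in the directions conjugate to it. *)
Lemma A2_orth_le n (A : 'M[R]_n) (e z : 'cV[R]_n) : (1 < n)%N -> A2_class A ->
  dot (A *m e) z = 0 ->
  dot e e * dot z z <= dot (A *m e) (A *m e) * dot (A *m z) (A *m z).
Proof.
move=> n1 [[AT _] [lam [Alam [zeta [_ s2 lamE]]]]] ez.
have [P [PP PA]] := spectral AT Alam.
have PPT : P *m P^T = 1%:M by exact: mulmx1C.
have dP x y : dot (P *m x) (P *m y) = dot x y.
  by rewrite dot_mulmxl mulmxA PP mul1mx.
have PAx x : P *m (A *m x) = \col_i (lam i * (P *m x) i 0).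
  have -> : P *m (A *m x) = diag_mx (\row_i lam i) *m (P *m x).
    by rewrite -PA -!mulmxA (mulmxA P^T) PP mul1mx.
  by apply/colP => i; rewrite mul_diag_mx !mxE.
rewrite -(dP e e) -(dP z z) -(dP (A *m e) (A *m e)) -(dP (A *m z) (A *m z)).
rewrite !PAx !dot_sum_sqr.
rewrite [X in _ <= X * _](eq_bigr (fun i => (lam i * (P *m e) i 0) ^+ 2)); last by move=> i _; rewrite mxE.
rewrite [X in _ <= _ * X](eq_bigr (fun i => (lam i * (P *m z) i 0) ^+ 2)); last by move=> i _; rewrite mxE.
apply: weighted_orth_le => //.
  by move=> i j ij; exact: A2_eigenvalues_prod s2 lamE ij.
rewrite -[RHS]ez -[RHS]dP PAx; apply: eq_bigr => i _.
by rewrite [X in _ = X * _]mxE mulrA.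
Qed.

End symmetric_matrices.

(** * Averages over the unit ball and their lower bound *)

Section ball_averages.
Context {R : realType}.

Lemma le_eq_trans2 (a b c d : \bar R) : a = b -> c = d -> (a <= c -> b <= d)%E.
Proof. by move=> -> ->. Qed.

Lemma ler_sqr_nneg (a b : R) : 0 <= a -> a <= b -> a ^+ 2 <= b ^+ 2.
Proof. by move=> a0 ab; rewrite ler_pXn2r ?nnegrE // (le_trans a0 ab). Qed.

Lemma colmeasM n (F G : 'cV[R]_n -> R) : colmeas F -> colmeas G ->
  colmeas (fun y => F y * G y).
Proof. by move=> mF mG; apply: measurable_funM. Qed.

Lemma colmeasD n (F G : 'cV[R]_n -> R) : colmeas F -> colmeas G ->
  colmeas (fun y => F y + G y).
Proof. by move=> mF mG; apply: measurable_funD. Qed.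

Lemma colmeas_eD n (F G : 'cV[R]_n -> \bar R) : colmeas F -> colmeas G ->
  colmeas (fun y => F y + G y)%E.
Proof. by move=> mF mG; apply: emeasurable_funD. Qed.

Lemma colmeas_cst n (c : R) : colmeas (fun _ : 'cV[R]_n => c).
Proof. exact: measurable_cst. Qed.

Lemma colmeas_powR n (F : 'cV[R]_n -> R) p : colmeas F -> colmeas (fun y => F y `^ p).
Proof. by move=> mF; apply: (measurableT_comp (measurable_powR p) mF). Qed.

Lemma colmeas_norm n (F : 'cV[R]_n -> R) : colmeas F -> colmeas (fun y => `|F y|).
Proof. by move=> mF; apply: (measurableT_comp _ mF). Qed.

Lemma colmeas_sqr n (F : 'cV[R]_n -> R) : colmeas F -> colmeas (fun y => F y ^+ 2).
Proof. by move=> mF; apply: measurable_funX. Qed.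

Definition ball_int n (F : 'cV[R]_n -> R) : \bar R :=
  intRn (fun y => (unit_ball y * F y)%:E).

Lemma colmeas_ball n (F : 'cV[R]_n -> R) : colmeas F ->
  colmeas (fun y => (unit_ball y * F y)%:E).
Proof.
by move=> mF; apply: colmeas_EFin; apply: colmeasM => //; exact: colmeas_unit_ball.
Qed.

Lemma le_ball_int n (F G : 'cV[R]_n -> R) : colmeas F -> colmeas G ->
  (forall y, 0 <= F y) -> (forall y, enorm y <= 1 -> F y <= G y) ->
  (ball_int F <= ball_int G)%E.
Proof.
move=> mF mG F0 FG; apply: le_intRn; [exact: colmeas_ball|exact: colmeas_ball| |].
  by move=> y; rewrite lee_fin mulr_ge0 // unit_ball_ge0.
move=> y; rewrite lee_fin /unit_ball; case: (leP (enorm y) 1) => [/FG|_].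
  by rewrite !mul1r.
by rewrite !mul0r.
Qed.

Lemma ball_int_ge0 n (F : 'cV[R]_n -> R) : (forall y, 0 <= F y) -> (0 <= ball_int F)%E.
Proof.
by move=> F0; apply: intRn_ge0 => y; rewrite lee_fin mulr_ge0 // unit_ball_ge0.
Qed.

Lemma ball_intD n (F G : 'cV[R]_n -> R) : colmeas F -> colmeas G ->
  (forall y, 0 <= F y) -> (forall y, 0 <= G y) ->
  ball_int (fun y => F y + G y) = (ball_int F + ball_int G)%E.
Proof.
move=> mF mG F0 G0; rewrite /ball_int -intRnD.
- by apply: eq_intRn => y; rewrite mulrDr EFinD.
- exact: colmeas_ball.
- exact: colmeas_ball.
- by move=> y; rewrite lee_fin mulr_ge0 // unit_ball_ge0.
- by move=> y; rewrite lee_fin mulr_ge0 // unit_ball_ge0.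
Qed.

Lemma ball_int_cst n (c : R) : 0 <= c ->
  ball_int (fun _ : 'cV[R]_n => c) = (c%:E * intRn (fun y : 'cV[R]_n => (unit_ball y)%:E))%E.
Proof.
move=> c0; rewrite -intRnZ //.
- by apply: eq_intRn => y; rewrite -EFinM mulrC.
- by apply: colmeas_EFin; exact: colmeas_unit_ball.
- by move=> y; rewrite lee_fin unit_ball_ge0.
Qed.

Lemma ball_int_fin n (F : 'cV[R]_n -> R) (c : R) : colmeas F ->
  (forall y, 0 <= F y) -> (forall y, enorm y <= 1 -> F y <= c) ->
  ball_int F \is a fin_num.
Proof.
move=> mF F0 Fc; rewrite ge0_fin_numE ?ball_int_ge0 //.
have c0 : 0 <= c.
  apply: le_trans (Fc 0 _) => //; rewrite le1_enorm big1 // => i _.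
  by rewrite mxE expr0n.
apply: (@le_lt_trans _ _ (ball_int (fun _ => c))).
  by apply: le_ball_int => //; exact: colmeas_cst.
by rewrite ball_int_cst // -(fineK (@intRn_unit_ball_fin R n)) -EFinM ltry.
Qed.

Lemma enorm_powR n (y : 'cV[R]_n) s : enorm y `^ s = (dot y y) `^ (s / 2).
Proof.
rewrite dot_sum_sqr /enorm -powR12_sqrt -?powRrM ?(mulrC s) //.
by rewrite sumr_ge0 // => i _; exact: sqr_ge0.
Qed.

Lemma enorm_dotE n (y : 'cV[R]_n) : enorm y ^+ 2 = dot y y.
Proof. by rewrite enorm_sqr dot_sum_sqr. Qed.

Definition tail_sqr n (y : 'cV[R]_n.+1) : R := \sum_(i | i != ord0) y i 0 ^+ 2.

Lemma tail_sqr_ge0 n (y : 'cV[R]_n.+1) : 0 <= tail_sqr y.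
Proof. by apply: sumr_ge0 => i _; exact: sqr_ge0. Qed.

Lemma dot_tail n (y : 'cV[R]_n.+1) : dot y y = y ord0 0 ^+ 2 + tail_sqr y.
Proof. by rewrite dot_sum_sqr; exact: bigD1. Qed.

Lemma colmeas_tail_sqr n : colmeas (@tail_sqr n).
Proof.
rewrite (_ : @tail_sqr n = fun y => \sum_(i < n.+1) (if i != ord0 then y i 0 ^+ 2 else 0)).
  apply: colmeas_sum => i; case: (i != ord0); last exact: colmeas_cst.
  by apply: colmeas_sqr; exact: colmeas_coord.
by apply/funext => y; rewrite /tail_sqr big_mkcond.
Qed.

Definition op_density n s (A : 'M[R]_n.+1) (y : 'cV[R]_n.+1) : R :=
  `|(A *m y) ord0 0| `^ s * enorm (A *m y) `^ s.

(** The integrand of J_c.  The value [c = 0] is the limit of [op_density] along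
    the degenerating family. *)
Definition axial_density n s c (y : 'cV[R]_n.+1) : R :=
  `|y ord0 0| `^ s * (c * y ord0 0 ^+ 2 + tail_sqr y) `^ (s / 2).

Lemma op_density_ge0 n s (A : 'M[R]_n.+1) y : 0 <= op_density s A y.
Proof. by rewrite mulr_ge0 ?powR_ge0. Qed.

Lemma axial_density_ge0 n s c (y : 'cV[R]_n.+1) : 0 <= axial_density s c y.
Proof. by rewrite mulr_ge0 ?powR_ge0. Qed.

Lemma colmeas_op_density n s (A : 'M[R]_n.+1) : colmeas (op_density s A).
Proof.
apply: (colmeas_mulmx (F := fun z => `|z ord0 0| `^ s * enorm z `^ s)).
apply: colmeasM; apply: colmeas_powR; last exact: colmeas_enorm.
by apply: colmeas_norm; exact: colmeas_coord.
Qed.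

Lemma colmeas_axial_density n s c : colmeas (@axial_density n s c).
Proof.
apply: colmeasM; apply: colmeas_powR.
  by apply: colmeas_norm; exact: colmeas_coord.
apply: colmeasD; last exact: colmeas_tail_sqr.
apply: colmeasM; first exact: colmeas_cst.
by apply: colmeas_sqr; exact: colmeas_coord.
Qed.

Lemma unit_ball_mulmx n (O : 'M[R]_n) y : O^T *m O = 1%:M ->
  unit_ball (O *m y) = unit_ball y.
Proof. by move=> OO; rewrite /unit_ball enorm_mulmx. Qed.

Lemma ball_int_orth n (O : 'M[R]_n.+1) (F : 'cV[R]_n.+1 -> R) :
  O^T *m O = 1%:M -> colmeas F -> (forall y, 0 <= F y) ->
  ball_int (fun y => F (O *m y)) = ball_int F.
Proof.
move=> OO mF F0.
rewrite /ball_int -[RHS](@intRn_mulmx_orth _ _ O) //.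
- by apply: eq_intRn => y; rewrite unit_ball_mulmx.
- exact: colmeas_ball.
- by move=> y; rewrite lee_fin mulr_ge0 // unit_ball_ge0.
Qed.

(** The left-hand side is the value of [axial_density] on the unit sphere, as a
    function of the first coordinate only. *)
Lemma axial_boundary_le n (s c : R) (y : 'cV[R]_n.+1) : 0 <= s -> 0 <= c -> enorm y <= 1 ->
  `|y ord0 0| `^ s * (c * y ord0 0 ^+ 2 + (1 - y ord0 0 ^+ 2)) `^ (s / 2) <=
  (c + 1) `^ (s / 2).
Proof.
move=> s0 c0 y1.
have y01 : `|y ord0 0| <= 1 by exact: le_trans (coord_le_enorm _ _) y1.
have y0sq : y ord0 0 ^+ 2 <= 1.
  by rewrite -real_normK ?num_real // expr_le1.
have s20 : 0 <= s / 2 by rewrite divr_ge0.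
rewrite -[leRHS]mul1r ler_pM ?powR_ge0 //.
  have -> : 1 = 1 `^ s :> R by rewrite powR1.
  by rewrite ge0_ler_powR // nnegrE.
have sq0 := sqr_ge0 (y ord0 0).
rewrite ge0_ler_powR // ?nnegrE; nra.
Qed.

(** The right-hand integrand is [axial_density] composed with a shear [S] that
    keeps the first coordinate, so the claim compares the integrals of
    [axial_density] over the ball and over its image [S B], whose sections
    at fixed [y_1] are translates of those of the ball.  Let [tau] be the value of
    [axial_density] on the unit sphere at the given [y_1].  As [axial_density]
    increases with |y'|, it is at most [tau] inside the ball and at least [tau]
    outside; hence moving mass from the ball to [S B] can only increase the
    integral.  Formally, [axial_density] and [tau] are exchanged between the two
    indicators in a pointwise inequality, and the integrals of [tau], equal by
    invariance under [S], are subtracted. *)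
Lemma ball_int_shear_ge n (s c : R) (q : 'cV[R]_n.+1) : 0 <= s -> 0 <= c ->
  q ord0 0 = 1 ->
  (ball_int (@axial_density n s c) <=
   ball_int (fun y => `|y ord0 0|%R `^ s *
     (c * y ord0 0 ^+ 2 + dot (y - y ord0 0 *: q) (y - y ord0 0 *: q)) `^ (s / 2))%R)%E.
Proof.
move=> s0 c0 q0; set G := (fun y => _ : R).
pose r : 'cV[R]_n.+1 := evec n - q.
have r0 : r ord0 0 = 0 by rewrite !mxE !eqxx q0 subrr.
pose S (y : 'cV[R]_n.+1) := y + y ord0 0 *: r.
have S0 y : S y ord0 0 = y ord0 0 by rewrite mxE mxE r0 mulr0 addr0.
have Stail y : tail_sqr (S y) = dot (y - y ord0 0 *: q) (y - y ord0 0 *: q).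
  rewrite dot_tail mxE mxE mxE q0 mulr1 subrr expr0n add0r.
  apply: eq_bigr => i i0; rewrite !mxE (negbTE i0) /=; ring.
have GE y : G y = axial_density s c (S y) by rewrite /axial_density Stail S0.
pose tau (y : 'cV[R]_n.+1) : R :=
  `|y ord0 0| `^ s * (c * y ord0 0 ^+ 2 + (1 - y ord0 0 ^+ 2)) `^ (s / 2).
have tauS y : tau (S y) = tau y by rewrite /tau S0.
have tau0 y : 0 <= tau y by rewrite mulr_ge0 ?powR_ge0.
have mtau : colmeas tau.
  apply: colmeasM; apply: colmeas_powR.
    by apply: colmeas_norm; exact: colmeas_coord.
  apply: colmeasD; first (apply: colmeasM; first exact: colmeas_cst).
    by apply: colmeas_sqr; exact: colmeas_coord.
  rewrite (_ : (fun _ => _) = fun y : 'cV[R]_n.+1 => 1 + (-1) * y ord0 0 ^+ 2).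
    apply: colmeasD; first exact: colmeas_cst.
    apply: colmeasM; first exact: colmeas_cst.
    by apply: colmeas_sqr; exact: colmeas_coord.
  by apply/funext => y; ring.
have taufin : ball_int tau \is a fin_num.
  by apply: (ball_int_fin (c := (c + 1) `^ (s / 2))) => // y; exact: axial_boundary_le.
have mS d (Z : measurableType d) (F : 'cV[R]_n.+1 -> Z) : colmeas F -> colmeas (fun y => F (S y)).
  move=> mF; apply: (colmeas_comp mF) => i.
  rewrite (_ : (fun _ => _) = fun t => tcol t i 0 + tcol t ord0 0 * r i 0).
    apply: measurable_funD; first exact: measurable_tcol.
    by apply: measurable_funM => //; exact: measurable_tcol.
  by apply/funext => t; rewrite !mxE.
have ballS (F : 'cV[R]_n.+1 -> R) : colmeas F -> (forall y, 0 <= F y) ->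
    ball_int F = intRn (fun y => (unit_ball (S y) * F (S y))%:E).
  move=> mF F0; apply/esym/(intRn_shear (F := fun y => (unit_ball y * F y)%:E)) => //.
    exact: colmeas_ball.
  by move=> y; rewrite lee_fin mulr_ge0 // unit_ball_ge0.
have mB := @colmeas_unit_ball R n.+1.
have mP := @colmeas_axial_density n s c.
have B0 := @unit_ball_ge0 R n.+1.
have P0 := @axial_density_ge0 n s c.
rewrite -(leeD2rE _ _ taufin).
have mSP : colmeas (fun y => (unit_ball (S y) * axial_density s c (S y))%:E).
  by apply: (mS _ _ (fun y => (unit_ball y * axial_density s c y)%:E)); exact: colmeas_ball.
have mSt : colmeas (fun y => (unit_ball (S y) * tau (S y))%:E).
  by apply: (mS _ _ (fun y => (unit_ball y * tau y)%:E)); exact: colmeas_ball.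
have mG : colmeas G.
  rewrite (_ : G = axial_density s c \o S); first exact: mS.
  exact/funext.
have mBt := colmeas_ball mtau; have mBG := colmeas_ball mG.
have Bt0 y : (0 <= (unit_ball y * tau y)%:E)%E by rewrite lee_fin mulr_ge0.
have BG0 y : (0 <= (unit_ball y * G y)%:E)%E by rewrite lee_fin mulr_ge0 // GE.
have SP0 y : (0 <= (unit_ball (S y) * axial_density s c (S y))%:E)%E.
  by rewrite lee_fin mulr_ge0.
have St0 y : (0 <= (unit_ball (S y) * tau (S y))%:E)%E by rewrite lee_fin mulr_ge0.
rewrite [X in (X + _ <= _)%E](ballS _ mP P0) [X in (_ <= _ + X)%E](ballS _ mtau tau0).
apply: (le_eq_trans2 (intRnD mSP mBt SP0 Bt0) (intRnD mBG mSt BG0 St0)).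
apply: le_intRn.
- exact: (colmeas_eD mSP mBt).
- exact: (colmeas_eD mBG mSt).
- by move=> y; exact: adde_ge0.
move=> y; rewrite -!EFinD lee_fin tauS GE.
have s20 : 0 <= s / 2 by rewrite divr_ge0.
have dotS : dot (S y) (S y) = y ord0 0 ^+ 2 + tail_sqr (S y) by rewrite dot_tail S0.
have h0 := sqr_ge0 (y ord0 0).
have t0 := tail_sqr_ge0 (S y).
rewrite /unit_ball -(@expr_le1 _ 2 (enorm y)) ?enorm_ge0 // enorm_dotE.
rewrite -(@expr_le1 _ 2 (enorm (S y))) ?enorm_ge0 // enorm_dotE dotS.
have [yB|yB] := leP (dot y y) 1; have [SB|SB] := leP (_ + tail_sqr (S y)) 1;
  rewrite ?mul1r ?mul0r ?addr0 ?add0r ?(addrC (tau y)) //.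
- rewrite /tau /axial_density S0; apply: ler_wpM2l; first exact: powR_ge0.
  have yy : y ord0 0 ^+ 2 <= 1 by apply: le_trans yB; rewrite dot_tail lerDl tail_sqr_ge0.
  by apply: ge0_ler_powR => //; rewrite ?nnegrE; nra.
- rewrite /tau /axial_density S0; apply: ler_wpM2l; first exact: powR_ge0.
  by apply: ge0_ler_powR => //; rewrite ?nnegrE; nra.
Qed.

Lemma posdef_unitmx n (A : 'M[R]_n) : sym_posdef A -> A \in unitmx.
Proof.
move=> [AT Apos]; rewrite -row_free_unit -kermx_eq0; apply/eqP/row_matrixP => i.
rewrite row0; apply/eqP/negP => /negP ki.
have kA : row i (kermx A) *m A = 0 by rewrite -row_mul mulmx_ker row0.
have := Apos (row i (kermx A))^T; rewrite trmx_eq0 => /(_ ki).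
by rewrite /quad_form trmxK kA mul0mx mxE ltxx.
Qed.

Lemma posdef_mul_neq0 n (A : 'M[R]_n) (y : 'cV[R]_n) :
  sym_posdef A -> y != 0 -> A *m y != 0.
Proof.
move=> Apd y0; apply: contra_neq y0 => Ay.
by rewrite -[y](mulKmx (posdef_unitmx Apd)) Ay mulmx0.
Qed.

(** Put [v = A e], [N = |v|] and [p = A^-1 e], so that [v . p = 1].  A vector
    [x] splits as [(v . x) p + z] with [z] orthogonal to [v]; then [A x] is the
    orthogonal sum of [(v . x) e] and [A z], and |A z| >= |z| / N by
    [A2_orth_le].  In coordinates [y = H x], where the reflection [H] takes
    [v / N] to [e], one has [v . x = N y_1], and [z] becomes [y - y_1 q].  The
    factor [N^s] coming from |(A x)_1|^s is absorbed into the second factor,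
    which produces the coefficient [N^4] of [y_1^2]. *)
Lemma ball_int_op_ge n (s : R) (A : 'M[R]_n.+2) : 0 <= s -> A2_class A ->
  (ball_int (@axial_density n.+1 s (dot (A *m evec _) (A *m evec _) ^+ 2)) <=
   ball_int (op_density s A))%E.
Proof.
move=> s0 AA2; have Apd : sym_posdef A by case: AA2.
have AT : A^T = A by case: Apd.
set e := evec n.+1; pose v := A *m e; rewrite -/v.
have e0 : e != 0 by rewrite -dot_gt0 evec_norm.
have v0 : v != 0 by exact: posdef_mul_neq0.
have vv : 0 < dot v v by rewrite dot_gt0.
pose N := Num.sqrt (dot v v).
have N0 : 0 < N by rewrite sqrtr_gt0.
have NN : N ^+ 2 = dot v v by rewrite sqr_sqrtr ?ltW.
pose f := N^-1 *: v.
have vf : v = N *: f by rewrite scalerA divff ?scale1r // gt_eqF.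
have ff : dot f f = 1.
  by rewrite dotZl dotZr mulrA -invfM -expr2 NN mulVf // gt_eqF.
have [H [HT HH Hf]] := reflection_evec ff.
pose p := invmx A *m e.
have Ap : A *m p = e by rewrite mulKVmx // posdef_unitmx.
have vp : dot v p = 1 by rewrite /v dot_mulmxl AT Ap evec_norm.
pose q := N *: (H *m p).
have HTH : H^T *m H = 1%:M by rewrite HT.
have dotH x y : dot (H *m x) (H *m y) = dot x y.
  by rewrite dot_mulmxl mulmxA HTH mul1mx.
have Hfe : H *m f = e by rewrite -Hf mulmxA HH mul1mx.
have q0 : q ord0 0 = 1.
  by rewrite -dot_evec -/e -Hfe /q dotZr dotH -dotZl -vf.
set c := dot v v ^+ 2.
have c0 : 0 <= c by exact: sqr_ge0.
apply: le_trans (ball_int_shear_ge s0 c0 q0) _.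
rewrite -(ball_int_orth HTH (colmeas_op_density s A) (op_density_ge0 s A)).
apply: le_ball_int.
- apply: colmeasM; apply: colmeas_powR.
    by apply: colmeas_norm; exact: colmeas_coord.
  apply: colmeasD.
    apply: colmeasM; first exact: colmeas_cst.
    by apply: colmeas_sqr; exact: colmeas_coord.
  apply: colmeas_sum => i; rewrite -/(GRing.mul _ _).
  have mi : colmeas (fun y : 'cV[R]_n.+2 => (y - y ord0 0 *: q) i 0).
    rewrite (_ : (fun _ => _) = fun y : 'cV[R]_n.+2 => y i 0 + (- q i 0) * y ord0 0).
      apply: colmeasD; first exact: colmeas_coord.
      by apply: colmeasM; [exact: colmeas_cst|exact: colmeas_coord].
    by apply/funext => y; rewrite !mxE; ring.
  exact: colmeasM.
- by apply: colmeas_mulmx; exact: colmeas_op_density.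
- by move=> y; rewrite mulr_ge0 ?powR_ge0.
move=> y _; rewrite /op_density.
set x := H *m y.
have Aev w : (A *m w) ord0 0 = dot v w.
  by rewrite -[LHS]dot_evec [LHS]dotC dot_mulmxl AT dotC.
have vx : dot v x = N * y ord0 0.
  by rewrite vf dotZl -(dotH f) Hfe /x mulmxA HH mul1mx dot_evec.
have Ax0 : (A *m x) ord0 0 = N * y ord0 0 by rewrite Aev.
pose z := x - dot v x *: p.
have vz : dot v z = 0 by rewrite dotDr dotNr dotZr vp mulr1 subrr.
have Az : dot e (A *m z) = 0 by rewrite dotC dot_mulmxl AT dotC.
have Axz : A *m x = (N * y ord0 0) *: e + A *m z.
  by rewrite mulmxBr -scalemxAr Ap -vx addrC subrK.
have dAx : dot (A *m x) (A *m x) = (N * y ord0 0) ^+ 2 + dot (A *m z) (A *m z).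
  rewrite Axz !dotDl !dotDr !dotZl !dotZr evec_norm Az (dotC _ e) Az.
  ring.
have key : dot z z <= N ^+ 2 * dot (A *m z) (A *m z).
  have := @A2_orth_le R _ A e z isT AA2 vz.
  by rewrite evec_norm mul1r -/v NN.
have Hz : H *m z = y - y ord0 0 *: q.
  rewrite mulmxBr /x mulmxA HH mul1mx -scalemxAr vx /q scalerA.
  by rewrite (mulrC N).
rewrite -Hz dotH Ax0 enorm_powR dAx normrM powRM ?normr_ge0 //.
rewrite (gtr0_norm N0) [leRHS]mulrAC.
have -> : N `^ s = (N ^+ 2) `^ (s / 2).
  by rewrite -powR_mulrn ?ltW // -powRrM; congr powR; field.
rewrite -powRM ?sqr_ge0 //; last by rewrite addr_ge0 ?sqr_ge0 ?dot_ge0.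
rewrite [leLHS]mulrC; apply: ler_wpM2r; first exact: powR_ge0.
have s20 : 0 <= s / 2 by rewrite divr_ge0.
apply: ge0_ler_powR => //; rewrite ?nnegrE.
- by rewrite addr_ge0 ?dot_ge0 // mulr_ge0 // sqr_ge0.
- by rewrite mulr_ge0 ?sqr_ge0 // addr_ge0 ?sqr_ge0 ?dot_ge0.
rewrite mulrDr (_ : N ^+ 2 * (N * y ord0 0) ^+ 2 = c * y ord0 0 ^+ 2).
  by rewrite lerD2l.
by rewrite /c -NN; ring.
Qed.

Lemma axial_density_mono n (s c d : R) (y : 'cV[R]_n.+1) : 0 <= s -> 0 <= c <= d ->
  axial_density s c y <= axial_density s d y.
Proof.
move=> s0 /andP[c0 cd]; apply: ler_wpM2l; first exact: powR_ge0.
have y0 := sqr_ge0 (y ord0 0); have t0 := tail_sqr_ge0 y.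
by apply: ge0_ler_powR; rewrite ?nnegrE ?divr_ge0 //; nra.
Qed.

Lemma axial_density_le1 n (s c : R) (y : 'cV[R]_n.+1) : 0 <= s -> 0 <= c ->
  enorm y <= 1 -> axial_density s c y <= (c + 1) `^ (s / 2).
Proof.
move=> s0 c0 y1; apply: le_trans (axial_boundary_le s0 c0 y1).
apply: ler_wpM2l; first exact: powR_ge0.
have := y1; rewrite -(@expr_le1 _ 2) ?enorm_ge0 // enorm_dotE dot_tail => h.
have y0 := sqr_ge0 (y ord0 0); have t0 := tail_sqr_ge0 y.
by apply: ge0_ler_powR; rewrite ?nnegrE ?divr_ge0 //; nra.
Qed.

Lemma ball_int_axial_fin n (s c : R) : 0 <= s -> 0 <= c ->
  ball_int (@axial_density n s c) \is a fin_num.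
Proof.
move=> s0 c0; apply: ball_int_fin (colmeas_axial_density s c) (axial_density_ge0 s c) _.
by move=> y; exact: axial_density_le1.
Qed.

Section box_gap.
Variables (n : nat) (s c : R).
Hypotheses (s0 : 0 < s) (c0 : 0 <= c).
Let a : R := box_side n.+1.

Lemma box_interior (y : 'cV[R]_n.+2) : (forall i, a <= y i 0 <= 2 * a) ->
  [/\ enorm y <= 1, a <= y ord0 0 & a ^+ 2 <= tail_sqr y <= 1].
Proof.
move=> h; have a0 : 0 < a by exact: box_side_gt0.
have y1 : enorm y <= 1.
  have : box a (2 * a) y <= unit_ball y.
    by apply: box_le_unit_ball; [exact: ltW|exact: box_side_le].
  rewrite boxP; case: forallP => // _.
  by rewrite /unit_ball; case: (leP (enorm y) 1) => // _; rewrite ler10.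
have /andP[ay _] := h ord0; split => //; apply/andP; split.
  rewrite /tail_sqr (bigD1 (lift ord0 ord0)) //= -[a ^+ 2]addr0 lerD //.
    have /andP[l _] := h (lift ord0 ord0).
    by apply: ler_sqr_nneg => //; exact: ltW.
  by apply: sumr_ge0 => i _; exact: sqr_ge0.
move: y1; rewrite -(@expr_le1 _ 2) ?enorm_ge0 // enorm_dotE dot_tail.
by apply: le_trans; rewrite lerDr sqr_ge0.
Qed.

Lemma box_axial_ge (y : 'cV[R]_n.+2) :
  a `^ s * (a ^+ 2) `^ (s / 2) * box a (2 * a) y <= unit_ball y * axial_density s 0 y.
Proof.
have a0 : 0 < a by exact: box_side_gt0.
rewrite boxP; case: forallP => [h|_]; last first.
  by rewrite mulr0 mulr_ge0 ?unit_ball_ge0 ?axial_density_ge0.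
have [y1 ay /andP[ta _]] := box_interior h.
rewrite /unit_ball y1 mulr1 mul1r /axial_density mul0r add0r.
have a20 : 0 <= a ^+ 2 by exact: sqr_ge0.
apply: ler_pM; rewrite ?powR_ge0 //.
  apply: ge0_ler_powR; rewrite ?nnegrE ?normr_ge0 ?(ltW a0) ?(ltW s0) //.
  by apply: le_trans ay (ler_norm _).
by apply: ge0_ler_powR; rewrite ?nnegrE ?divr_ge0 ?tail_sqr_ge0 // ltW.
Qed.

(** On the corner box [tail_sqr] is at most 1 and [y_1] at least [a], so that
    c y_1^2 + |y'|^2 >= (1 + c a^2) |y'|^2 there. *)
Lemma box_axial_gap (y : 'cV[R]_n.+2) :
  ((1 + c * a ^+ 2) `^ (s / 2) - 1) * (a `^ s * (a ^+ 2) `^ (s / 2)) * box a (2 * a) y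
  + unit_ball y * axial_density s 0 y <= unit_ball y * axial_density s c y.
Proof.
have a0 : 0 < a by exact: box_side_gt0.
have s20 : 0 <= s / 2 by rewrite divr_ge0 // ltW.
have c1 : 1 <= 1 + c * a ^+ 2 by rewrite lerDl mulr_ge0 // sqr_ge0.
set K := (1 + _) `^ _.
have K1 : 0 <= K - 1 by rewrite subr_ge0 -[leLHS](powRr0 (1 + c * a ^+ 2)) ler_powR.
have bge := box_axial_ge y; move: (bge); rewrite -mulrA boxP.
case: forallP => [h _|_ _]; last first.
  rewrite mulr0 add0r ler_wpM2l ?unit_ball_ge0 //.
  by apply: axial_density_mono; [exact: ltW|rewrite lexx].
have [y1 ay /andP[ta t1]] := box_interior h.
have a20 : 0 <= a ^+ 2 by exact: sqr_ge0.
have t0 : 0 <= tail_sqr y by exact: tail_sqr_ge0.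
move: bge; rewrite boxP; case: forallP => // _ bge; rewrite -mulrA.
apply: (@le_trans _ _ (K * (unit_ball y * axial_density s 0 y))).
  rewrite mulr1 in bge *; set W := unit_ball y * _ in bge *.
  have -> : K * W = (K - 1) * W + W by ring.
  by rewrite lerD2r; apply: ler_wpM2l.
rewrite /unit_ball y1 !mul1r /axial_density mulrCA.
apply: ler_wpM2l; first exact: powR_ge0.
rewrite mul0r add0r -powRM //; last by exact: le_trans c1.
have ya : a ^+ 2 <= y ord0 0 ^+ 2.
  by apply: ler_sqr_nneg => //; exact: ltW.
apply: ge0_ler_powR; rewrite ?nnegrE //.
- by rewrite mulr_ge0 //; exact: le_trans c1.
- by rewrite addr_ge0 // mulr_ge0 // sqr_ge0.
rewrite mulrDl mul1r addrC lerD2r -mulrA ler_wpM2l //.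
by apply: le_trans ya; rewrite ler_piMr.
Qed.

Lemma ball_int_axial_gap : 0 < c ->
  (ball_int (@axial_density n.+1 s 0) < ball_int (@axial_density n.+1 s c))%E.
Proof.
move=> cgt0; have a0 : 0 < a by exact: box_side_gt0.
set d := ((1 + c * a ^+ 2) `^ (s / 2) - 1) * (a `^ s * (a ^+ 2) `^ (s / 2)).
have d0 : 0 < d.
  rewrite mulr_gt0 // ?mulr_gt0 ?powR_gt0 ?exprn_gt0 // subr_gt0.
  rewrite [ltLHS](_ : 1 = 1 `^ (s / 2)); last by rewrite powR1.
  have h : 0 < c * a ^+ 2 by rewrite mulr_gt0 // exprn_gt0.
  by apply: gt0_ltr_powR; rewrite ?nnegrE ?divr_gt0 ?ltrDl // addr_ge0 // ltW.
have fin0 : ball_int (@axial_density n.+1 s 0) \is a fin_num.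
  by apply: ball_int_axial_fin => //; exact: ltW.
have box0 := @intRn_small_box R n.+1.
apply: (@lt_le_trans _ _ (d%:E * intRn (fun y : 'cV[R]_n.+2 => (box a (2 * a) y)%:E) +
    ball_int (@axial_density n.+1 s 0))%E).
  by rewrite -[ltLHS]add0e lteD2rE // mule_gt0 ?lte_fin.
rewrite -intRnZ; last 3 first.
- by apply: colmeas_EFin; exact: colmeas_box.
- by move=> y; rewrite lee_fin box_ge0.
- exact: ltW.
rewrite -intRnD; last 4 first.
- by apply: colmeas_EFin; apply: colmeasM; [exact: colmeas_cst|exact: colmeas_box].
- by apply: colmeas_ball; exact: colmeas_axial_density.
- by move=> y; rewrite mule_ge0 ?lee_fin ?box_ge0 // ltW.
- by move=> y; rewrite lee_fin mulr_ge0 ?unit_ball_ge0 ?axial_density_ge0.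
apply: le_intRn.
- apply: colmeas_EFin; apply: colmeasD.
    by apply: colmeasM; [exact: colmeas_cst|exact: colmeas_box].
  by apply: colmeasM; [exact: colmeas_unit_ball|exact: colmeas_axial_density].
- by apply: colmeas_ball; exact: colmeas_axial_density.
- move=> y; rewrite -EFinM -EFinD lee_fin addr_ge0 //.
    by rewrite mulr_ge0 ?box_ge0 // ltW.
  by rewrite mulr_ge0 ?unit_ball_ge0 ?axial_density_ge0.
by move=> y; rewrite -EFinM -EFinD lee_fin box_axial_gap.
Qed.

Lemma ball_int_axial_gt0 : (0 < ball_int (@axial_density n.+1 s 0))%E.
Proof.
have a0 : 0 < a by exact: box_side_gt0.
apply: (@lt_le_trans _ _ ((a `^ s * (a ^+ 2) `^ (s / 2))%:E *
    intRn (fun y : 'cV[R]_n.+2 => (box a (2 * a) y)%:E))%E).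
  by rewrite mule_gt0 ?intRn_small_box // lte_fin mulr_gt0 // powR_gt0 // exprn_gt0.
rewrite -intRnZ; last 3 first.
- by apply: colmeas_EFin; exact: colmeas_box.
- by move=> y; rewrite lee_fin box_ge0.
- by rewrite mulr_ge0 ?powR_ge0.
apply: le_intRn.
- by apply: colmeas_EFin; apply: colmeasM; [exact: colmeas_cst|exact: colmeas_box].
- by apply: colmeas_ball; exact: colmeas_axial_density.
- by move=> y; rewrite -EFinM lee_fin !mulr_ge0 ?box_ge0 ?powR_ge0.
by move=> y; rewrite -EFinM lee_fin box_axial_ge.
Qed.

End box_gap.

(** On [N_class L] one has |A e| >= e . A e >= 1 / L. *)
Lemma ball_int_op_N n (s L : R) (A : 'M[R]_n.+2) : 0 <= s -> 1 <= L ->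
  A2_class A -> N_class L A ->
  (ball_int (@axial_density n.+1 s (L ^- 4)) <= ball_int (op_density s A))%E.
Proof.
move=> s0 L1 AA2 [Apd LA _].
have L0 : 0 < L by exact: lt_le_trans L1.
apply: le_trans (ball_int_op_ge s0 AA2); apply: le_ball_int.
- exact: colmeas_axial_density.
- exact: colmeas_axial_density.
- by move=> y; exact: axial_density_ge0.
move=> y _; apply: axial_density_mono => //.
rewrite invr_ge0 exprn_ge0 ?(ltW L0) //=.
set e := evec n.+1.
have h : L^-1 <= dot e (A *m e).
  have := LA e; rewrite /quad_form -!mulmxA mul_scalar_mx -scalemxAr mxE !dotE.
  by rewrite evec_norm mulr1.
have cs : dot e (A *m e) ^+ 2 <= dot (A *m e) (A *m e).
  have := cauchy_schwarz xpredT (fun i => e i 0) (fun i => (A *m e) i 0).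
  by rewrite -!dot_sum_sqr evec_norm mul1r.
have Li0 : 0 < L^-1 by rewrite invr_gt0.
rewrite -exprVn (exprM _ 2 2) ler_pXn2r ?nnegrE ?sqr_ge0 ?dot_ge0 //.
apply: le_trans cs; rewrite ler_pXn2r ?nnegrE ?(ltW Li0) //.
exact: le_trans (ltW Li0) h.
Qed.

End ball_averages.

(** * The degenerating family *)

Section degenerate_family.
Context {R : realType} (n : nat).

Definition degenerate_zeta (t : R) (i : 'I_n.+2) : R :=
  if i == ord0 then t else if i == lift ord0 ord0 then t^-1 else 0.

(** The squared eigenvalues prescribed by [degenerate_zeta], whose sum is [t + t^-1]. *)
Definition degenerate_mu (t : R) (i : 'I_n.+2) : R := t + t^-1 - degenerate_zeta t i.

Definition degenerate_diag (t : R) (i : 'I_n.+2) : R := Num.sqrt (degenerate_mu t i).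

Definition degenerate_mx (t : R) : 'M[R]_n.+2 := diag_mx (\row_i degenerate_diag t i).

Lemma sum_degenerate_zeta (t : R) (f : R -> R) : f 0 = 0 ->
  \sum_i f (degenerate_zeta t i) = f t + f t^-1.
Proof.
move=> f0; rewrite !big_ord_recl /= big1 ?addr0; last first.
  by move=> i _; rewrite /degenerate_zeta -!val_eqE /= /bump /=.
by rewrite /degenerate_zeta -!val_eqE.
Qed.

Lemma degenerate_mu_sum (t : R) i : degenerate_mu t i = \sum_(j < n.+2 | j != i) degenerate_zeta t j.
Proof.
have := sum_degenerate_zeta t (f := id) erefl; rewrite (bigD1 i) //= /degenerate_mu => <-.
by rewrite addrAC subrr add0r.
Qed.

Lemma degenerate_sigma2 (t : R) : 0 < t -> sigma2 (degenerate_zeta t) = 1.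
Proof.
move=> t0; have := sigma2E (degenerate_zeta t); rewrite (sum_degenerate_zeta t (f := id)) //.
rewrite (sum_degenerate_zeta t (f := fun x => x ^+ 2)) ?expr0n //.
have -> : (t + t^-1) ^+ 2 - (t ^+ 2 + t^-1 ^+ 2) = 2 by field; rewrite gt_eqF.
by move=> h; apply: (@mulfI _ 2); rewrite ?pnatr_eq0 // mulr1.
Qed.

Lemma degenerate_muE (t : R) (i : 'I_n.+2) :
  degenerate_mu t i = if i == ord0 then t^-1 else if i == lift ord0 ord0 then t else t + t^-1.
Proof.
rewrite /degenerate_mu /degenerate_zeta; case: ifP => _; first by rewrite addrAC subrr add0r.
by case: ifP => _; rewrite ?addrK ?subr0.
Qed.

Lemma degenerate_mu_gt0 (t : R) (i : 'I_n.+2) : 0 < t -> 0 < degenerate_mu t i.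
Proof.
move=> t0; have ti : 0 < t^-1 by rewrite invr_gt0.
by rewrite degenerate_muE; case: ifP => // _; case: ifP => // _; rewrite addr_gt0.
Qed.

Lemma degenerate_diag_gt0 (t : R) (i : 'I_n.+2) : 0 < t -> 0 < degenerate_diag t i.
Proof. by move=> t0; rewrite sqrtr_gt0 degenerate_mu_gt0. Qed.

Lemma degenerate_diag_sqr (t : R) (i : 'I_n.+2) : 0 < t -> degenerate_diag t i ^+ 2 = degenerate_mu t i.
Proof. by move=> t0; rewrite sqr_sqrtr // ltW // degenerate_mu_gt0. Qed.

Lemma degenerate_mulmx (t : R) (y : 'cV[R]_n.+2) i : (degenerate_mx t *m y) i 0 = degenerate_diag t i * y i 0.
Proof. by rewrite mul_diag_mx !mxE. Qed.

Lemma degenerate_eigenvalues (t : R) : eigenvalues_of (degenerate_mx t) (degenerate_diag t).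
Proof.
rewrite /eigenvalues_of char_poly_trig; last first.
  by apply/is_trig_mxP => i j ij; rewrite !mxE -val_eqE ltn_eqF.
by apply: eq_bigr => i _; rewrite !mxE eqxx mulr1n.
Qed.

Lemma degenerate_A2 (t : R) : 0 < t -> A2_class (degenerate_mx t).
Proof.
move=> t0; split; first split.
- by rewrite /degenerate_mx tr_diag_mx.
- move=> x x0; rewrite /quad_form -mulmxA dotE /dot.
  have h i : 0 <= x i 0 * (degenerate_mx t *m x) i 0.
    by rewrite degenerate_mulmx mulrCA mulr_ge0 -?expr2 ?sqr_ge0 // ltW // degenerate_diag_gt0.
  rewrite lt_neqAle sumr_ge0 // andbT eq_sym psumr_neq0 //.
  have /existsP[i xi] : [exists i, x i 0 != 0].
    apply: contra_neqT x0; rewrite negb_exists => /forallP z.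
    by apply/colP => i; apply/eqP; rewrite mxE -[_ == _]negbK; exact: z.
  apply/hasP; exists i; rewrite ?mem_index_enum //= degenerate_mulmx mulrCA.
  by rewrite mulr_gt0 ?degenerate_diag_gt0 // -expr2 exprn_even_gt0.
exists (degenerate_diag t); split; first exact: degenerate_eigenvalues.
exists (degenerate_zeta t); split.
- rewrite /Gamma2 /= degenerate_sigma2 // ltr01; split => //.
  by rewrite /sigma1 (sum_degenerate_zeta t (f := id)) // addr_gt0 // invr_gt0.
- exact: degenerate_sigma2.
- by move=> i; rewrite degenerate_diag_sqr // degenerate_mu_sum.
Qed.

Lemma degenerate_eigenvalue (t : R) : eigenvalue (degenerate_mx t) (Num.sqrt t^-1).
Proof.
rewrite eigenvalue_root_char degenerate_eigenvalues /root horner_prod prodf_seq_eq0.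
apply/hasP; exists ord0; rewrite ?mem_index_enum //= hornerXsubC.
by rewrite /degenerate_diag degenerate_muE eqxx subrr.
Qed.

Lemma degenerate_frobenius_ge (t : R) : 0 < t -> Num.sqrt t <= frobenius (degenerate_mx t).
Proof.
move=> t0; rewrite /frobenius ler_sqrt; last first.
  rewrite /mxtrace sumr_ge0 // => i _.
  by rewrite mul_diag_mx !mxE eqxx mulr1n mulr_ge0 // ltW // degenerate_diag_gt0.
rewrite /mxtrace (eq_bigr (fun i => degenerate_mu t i)); last first.
  by move=> i _; rewrite mul_diag_mx !mxE eqxx mulr1n -expr2 degenerate_diag_sqr.
rewrite (bigD1 (lift ord0 ord0)) //= degenerate_muE -!val_eqE /=.
by rewrite lerDl sumr_ge0 // => i _; rewrite ltW // degenerate_mu_gt0.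
Qed.

(** By homogeneity one may take x + y = 1, and then z <= z^p for z in [0, 1]. *)
Lemma powR_subadd (x y p : R) : 0 <= x -> 0 <= y -> 0 < p <= 1 ->
  (x + y) `^ p <= x `^ p + y `^ p.
Proof.
move=> x0 y0 /andP[p0 p1]; have xy0 : 0 <= x + y by rewrite addr_ge0.
have [xy|xyn0] := eqVneq (x + y) 0.
  by rewrite xy powR0 ?gt_eqF // addr_ge0 ?powR_ge0.
have xy : 0 < x + y by rewrite lt_neqAle eq_sym xyn0.
have H z : 0 <= z -> z <= x + y -> (x + y) `^ p * (z / (x + y)) <= z `^ p.
  move=> z0 zxy; have [->|zn0] := eqVneq z 0; first by rewrite mul0r mulr0 powR_ge0.
  have zp : 0 < z by rewrite lt_neqAle eq_sym zn0.
  rewrite -[in leRHS](divfK xyn0 z) [in leRHS]mulrC powRM ?divr_ge0 //.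
  apply: ler_wpM2l; first exact: powR_ge0.
  by rewrite ger1_powR // divr_gt0 //= ler_pdivrMr // mul1r.
rewrite -[leLHS]mulr1 -(divff xyn0) mulrDl mulrDr.
by apply: lerD; apply: H => //; rewrite ?lerDl ?lerDr.
Qed.

(** The factor t^(-1/2) of the first coordinate, moved into the second factor,
    leaves |A y|^2 / t = |y'|^2 + t^-2 y_1^2 + t^-2 |y''|^2, with y'' the
    coordinates from the third on; subadditivity of the power s/2 separates the
    error t^-2. *)
Lemma degenerate_op_density_le (s t : R) (y : 'cV[R]_n.+2) : 0 < s < 1 -> 1 <= t ->
  enorm y <= 1 -> op_density s (degenerate_mx t) y <= axial_density s 0 y + t `^ (- s).
Proof.
move=> /andP[s0 s1] t1 y1; have t0 : 0 < t by exact: lt_le_trans t1.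
have ti : 0 < t^-1 by rewrite invr_gt0.
have s20 : 0 <= s / 2 by rewrite divr_ge0 // ltW.
have yy1 : dot y y <= 1 by rewrite -enorm_dotE expr_le1 // enorm_ge0.
have T0 := tail_sqr_ge0 y.
have y0 : `|y ord0 0| `^ s <= 1.
  have -> : 1 = 1 `^ s :> R by rewrite powR1.
  rewrite ge0_ler_powR ?nnegrE ?(ltW s0) //.
  exact: le_trans (coord_le_enorm _ _) y1.
rewrite /op_density degenerate_mulmx enorm_powR normrM powRM ?normr_ge0 //.
rewrite gtr0_norm ?degenerate_diag_gt0 //.
have -> : degenerate_diag t ord0 `^ s = (t^-1) `^ (s / 2).
  by rewrite /degenerate_diag degenerate_muE eqxx -powR12_sqrt ?ltW // -powRrM (mulrC s).
rewrite mulrAC -powRM ?dot_ge0 ?(ltW ti) // mulrC.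
have bound : t^-1 * dot (degenerate_mx t *m y) (degenerate_mx t *m y) <= tail_sqr y + t^-1 ^+ 2.
  have D : dot (degenerate_mx t *m y) (degenerate_mx t *m y) = \sum_i degenerate_mu t i * y i 0 ^+ 2.
    by rewrite dot_sum_sqr; apply: eq_bigr => i _; rewrite degenerate_mulmx exprMn degenerate_diag_sqr.
  apply: (@le_trans _ _ (tail_sqr y + t^-1 ^+ 2 * dot y y)); last first.
    by rewrite lerD2l ler_piMr // sqr_ge0.
  rewrite D mulr_sumr (bigD1 ord0) //= dot_tail mulrDr addrCA degenerate_muE eqxx mulrA -expr2.
  rewrite lerD2l /tail_sqr mulr_sumr -big_split /=; apply: ler_sum => i i0.
  rewrite mulrA -[X in _ <= X + _]mul1r -mulrDl ler_wpM2r ?sqr_ge0 //.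
  rewrite degenerate_muE (negbTE i0); case: ifP => _.
    by rewrite mulVf ?gt_eqF // lerDl sqr_ge0.
  by rewrite mulrDr mulVf ?gt_eqF // -expr2.
have tE : (t^-1 ^+ 2) `^ (s / 2) = t `^ (- s).
  rewrite -powR_mulrn ?(ltW ti) // -powRrM -powR_inv1 ?(ltW t0) // -powRrM.
  by congr powR; field.
apply: (@le_trans _ _ (`|y ord0 0| `^ s * (tail_sqr y + t^-1 ^+ 2) `^ (s / 2))).
  apply: ler_wpM2l; first exact: powR_ge0.
  apply: ge0_ler_powR; rewrite ?nnegrE //; last by rewrite addr_ge0 ?sqr_ge0.
  by rewrite mulr_ge0 ?dot_ge0 ?(ltW ti).
have s2b : 0 < s / 2 <= 1 by apply/andP; split; lra.
apply: (@le_trans _ _ (`|y ord0 0| `^ s *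
    (tail_sqr y `^ (s / 2) + (t^-1 ^+ 2) `^ (s / 2)))).
  by apply: ler_wpM2l; [exact: powR_ge0|rewrite powR_subadd ?sqr_ge0].
rewrite mulrDr /axial_density mul0r add0r lerD2l tE ler_piMl ?powR_ge0 //.
Qed.

Lemma degenerate_ball_int_le (s t : R) : 0 < s < 1 -> 1 <= t ->
  (ball_int (op_density s (degenerate_mx t)) <= ball_int (@axial_density R n.+1 s 0) +
    (t `^ (- s))%:E * intRn (fun y : 'cV[R]_n.+2 => (unit_ball y)%:E))%E.
Proof.
move=> s01 t1; rewrite -ball_int_cst ?powR_ge0 // -ball_intD; last 4 first.
- exact: colmeas_axial_density.
- exact: colmeas_cst.
- by move=> y; exact: axial_density_ge0.
- by move=> y; exact: powR_ge0.
apply: le_ball_int.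
- exact: colmeas_op_density.
- by apply: colmeasD; [exact: colmeas_axial_density|exact: colmeas_cst].
- by move=> y; exact: op_density_ge0.
- by move=> y; exact: degenerate_op_density_le.
Qed.

End degenerate_family.

(** * Power integrals on the half-line and positivity of the Gamma function *)

Section power_integrals.
Context {R : realType}.
Local Notation mu := (@lebesgue_measure R).

Lemma continuous_powR (p x : R) : 0 < x -> {for x, continuous (@powR R ^~ p)}.
Proof.
move=> x0; apply: differentiable_continuous; apply/derivable1_diffP.
exact: (@ex_derive _ _ _ _ _ _ _ (is_derive1_powR p x0)).
Qed.

Lemma powRN_cvg0 (m : R) : 0 < m -> x `^ (- m) @[x --> +oo] --> (0 : R).
Proof.
move=> m0; apply/cvgr0Pnorm_lt => e e0.
near=> x.
have x0 : 0 < x by near: x; exact: nbhs_pinfty_gt.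
rewrite powRN ger0_norm ?invr_ge0 ?powR_ge0 //.
rewrite invf_plt ?posrE ?powR_gt0 //.
have -> : e^-1 = (e^-1 `^ m^-1) `^ m.
  by rewrite -powRrM mulVf ?gt_eqF // powRr1 // invr_ge0 ltW.
apply: gt0_ltr_powR => //; rewrite ?nnegrE ?powR_ge0 ?(ltW x0) //.
Unshelve. all: by end_near. Qed.

Lemma integral_powR_tail (m r : R) : 0 < m -> 0 < r ->
  (\int[mu]_(t in `[r, +oo[) (t `^ (- m - 1))%:E = (r `^ (- m) / m)%:E)%E.
Proof.
move=> m0 r0.
pose F (t : R) := - m^-1 * t `^ (- m).
have dF (t : R) : 0 < t -> is_derive t 1 F (t `^ (- m - 1)).
  move=> t0; have H := is_derive1_powR (- m) t0.
  rewrite (_ : _ `^ (- m - 1) = - m^-1 *: (- m * t `^ (- m - 1))); last first.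
    by rewrite /GRing.scale /= mulrA mulrNN mulVf ?gt_eqF // mul1r.
  exact: is_deriveZ.
rewrite (@ge0_continuous_FTC2y _ (fun t => t `^ (- m - 1)) F r 0).
- by rewrite -EFinB /F sub0r mulNr opprK mulrC.
- by move=> x _; exact: powR_ge0.
- apply: continuous_in_subspaceT => x; rewrite inE /= in_itv /= andbT => rx.
  by apply: continuous_powR; exact: lt_le_trans rx.
- rewrite -(mulr0 (- m^-1)); apply: cvgM; first exact: cvg_cst.
  exact: powRN_cvg0.
- by move=> x rx; apply: (@ex_derive _ _ _ _ _ _ _ (dF x _)); exact: lt_trans rx.
- apply: cvg_at_right_filter; apply: differentiable_continuous; apply/derivable1_diffP.
  exact: (@ex_derive _ _ _ _ _ _ _ (dF r r0)).
- move=> x; rewrite in_itv /= andbT => rx; rewrite derive1E.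
  by apply: (@derive_val _ _ _ _ _ _ _ (dF x _)); exact: lt_trans rx.
Qed.

(** The bound does not depend on [k], so it survives the passage to the
    singular endpoint 0. *)
Lemma integral_powR_head (a : R) (k : nat) : 0 < a ->
  (\int[mu]_(t in `[k.+2%:R^-1%R, 1%R]) (t `^ (a - 1))%:E <= (a^-1)%:E)%E.
Proof.
move=> a0.
have k0 : 0 < k.+2%:R^-1 :> R by rewrite invr_gt0.
have k1 : k.+2%:R^-1 < 1 :> R by rewrite invf_lt1 // ltr1n.
pose F (t : R) := a^-1 * t `^ a.
have dF (t : R) : 0 < t -> is_derive t 1 F (t `^ (a - 1)).
  move=> t0; have H := is_derive1_powR a t0.
  rewrite (_ : _ `^ (a - 1) = a^-1 *: (a * t `^ (a - 1))); last first.
    by rewrite /GRing.scale /= mulrA mulVf ?gt_eqF // mul1r.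
  exact: is_deriveZ.
have cF (t : R) : 0 < t -> {for t, continuous F}.
  move=> t0; apply: differentiable_continuous; apply/derivable1_diffP.
  exact: (@ex_derive _ _ _ _ _ _ _ (dF t t0)).
rewrite (@continuous_FTC2 _ (fun t => t `^ (a - 1)) F) //.
- rewrite -EFinB lee_fin /F powR1 mulr1 lerBlDr lerDl.
  by rewrite mulr_ge0 ?powR_ge0 // invr_ge0 ltW.
- apply: continuous_in_subspaceT => x; rewrite inE /= in_itv /= => /andP[kx _].
  by apply: continuous_powR; exact: lt_le_trans kx.
- split.
  + move=> x; rewrite in_itv /= => /andP[kx _].
    by apply: (@ex_derive _ _ _ _ _ _ _ (dF x _)); exact: lt_trans kx.
  + by apply: cvg_at_right_filter; exact: cF.
  + by apply: cvg_at_left_filter; exact: cF.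
- move=> x; rewrite in_itv /= => /andP[kx _]; rewrite derive1E.
  by apply: (@derive_val _ _ _ _ _ _ _ (dF x _)); exact: lt_trans kx.
Qed.

Lemma measurable_powR_expR (a : R) (D : set R) :
  measurable_fun D (fun t : R => t `^ (a - 1) * expR (- t)).
Proof.
apply: (@measurable_funS _ _ _ _ setT) => //; apply: measurable_funM.
  exact: measurable_powR.
by apply: measurableT_comp => //; exact: measurable_expR.
Qed.

Lemma integral_gamma_head (a : R) : 0 < a ->
  (\int[mu]_(t in `]0%R, 1%R]) (t `^ (a - 1) * expR (- t))%:E <= (a^-1)%:E)%E.
Proof.
move=> a0.
pose D (k : nat) : set R := `[k.+2%:R^-1, 1]%classic.
have DE : `]0, 1]%classic = \bigcup_k D k.
  apply/seteqP; split => x /=.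
    rewrite in_itv /= => /andP[x0 x1].
    exists (Num.truncn x^-1) => //; rewrite /D /= in_itv /= x1 andbT.
    rewrite invf_ple ?posrE //; apply: (@le_trans _ _ (Num.truncn x^-1).+1%:R).
      by rewrite ltW // truncnS_gt.
    by rewrite ler_nat.
  move=> [k _]; rewrite /D /= !in_itv /= => /andP[kx ->]; rewrite andbT.
  by apply: lt_le_trans kx; rewrite invr_gt0.
rewrite DE.
have ndD : nondecreasing_seq D.
  apply/nondecreasing_seqP => k; apply/subsetPset => x; rewrite /D /= !in_itv /=.
  move=> /andP[kx ->]; rewrite andbT; apply: le_trans kx.
  by rewrite lef_pV2 ?posrE // ler_nat.
have mD k : measurable (D k) by exact: measurable_itv.
have mf k : measurable_fun (D k) (fun t => (t `^ (a - 1) * expR (- t))%:E).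
  by apply/measurable_EFinP; exact: measurable_powR_expR.
have f0 k x : D k x -> (0 <= (x `^ (a - 1) * expR (- x))%:E)%E.
  by move=> _; rewrite lee_fin mulr_ge0 ?powR_ge0 ?expR_ge0.
have cv := @ge0_nondecreasing_set_cvg_integral _ (measurableTypeR R) R D _ mu ndD mD mf f0.
apply: (cvge_le _ cv).
apply: nearW => k; apply: le_trans (integral_powR_head k a0).
apply: ge0_le_integral.
- exact: mD.
- exact: f0.
- exact: mf.
- by apply/measurable_EFinP; apply: (@measurable_funS _ _ _ _ setT).
move=> x; rewrite /D /= in_itv /= => /andP[kx _]; rewrite lee_fin.
have x0 : 0 <= x by apply: le_trans kx; rewrite invr_ge0.
by rewrite ler_piMr ?powR_ge0 // -expR0 ler_expR oppr_le0.
Qed.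

Lemma powR_le_fact_expR (N : nat) (p t : R) : 1 <= t -> p <= N.+1%:R ->
  t `^ p <= N.+1`!%:R * expR t.
Proof.
move=> t1 pN; have t0 : 0 <= t by exact: le_trans t1.
apply: (@le_trans _ _ (t ^+ N.+1)); first by rewrite -powR_mulrn // ler_powR.
have f0 : 0 < N.+1`!%:R :> R by rewrite ltr0n fact_gt0.
rewrite mulrC -ler_pdivrMr //; apply: le_trans (expR_ge1Dxn N t0).
by rewrite lerDr.
Qed.

Lemma integral_gamma_tail_lty (a : R) :
  (\int[mu]_(t in `[1%R, +oo[) (t `^ (a - 1) * expR (- t))%:E < +oo)%E.
Proof.
pose N := Num.truncn (a + 1); pose C : R := N.+1`!%:R.
have aN : a + 1 <= N.+1%:R by rewrite ltW // truncnS_gt.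
apply: (@le_lt_trans _ _ (\int[mu]_(t in `[1%R, +oo[) (C%:E * (t `^ (- 1 - 1))%:E))%E).
  apply: ge0_le_integral => //.
  - by move=> x _; rewrite lee_fin mulr_ge0 ?powR_ge0 ?expR_ge0.
  - by apply/measurable_EFinP; exact: measurable_powR_expR.
  - apply/measurable_EFinP; apply: (@measurable_funS _ _ _ _ setT) => //.
    by apply: measurable_funM => //; exact: measurable_powR.
  move=> x; rewrite /= in_itv /= andbT => x1; rewrite lee_fin.
  have x0 : 0 < x by exact: lt_le_trans x1.
  rewrite expRN ler_pdivrMr ?expR_gt0 // mulrAC -ler_pdivrMr ?powR_gt0 //.
  rewrite -powRB; last by apply/implyP => _; rewrite gt_eqF.
  rewrite (_ : a - 1 - (-1 - 1) = a + 1); last by ring.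
  exact: powR_le_fact_expR.
rewrite ge0_integralZl_EFin //.
- by rewrite integral_powR_tail // powR1 -EFinM ltry.
- by move=> x _; rewrite lee_fin powR_ge0.
- apply/measurable_EFinP; apply: (@measurable_funS _ _ _ _ setT) => //.
Qed.

(** [GammaE] is an extended real integral converted to a real number, which is
    0 if the integral diverges; hence positivity also needs the finiteness
    of the integral, near 0 and near infinity. *)
Lemma GammaE_gt0 (a : R) : 0 < a -> 0 < GammaE a.
Proof.
move=> a0.
have g0 (D : set R) x : D x -> (0 <= (x `^ (a - 1) * expR (- x))%:E)%E.
  by move=> _; rewrite lee_fin mulr_ge0 ?powR_ge0 ?expR_ge0.
have mg (D : set R) : measurable_fun D (fun x : R => (x `^ (a - 1) * expR (- x))%:E).
  by apply/measurable_EFinP; exact: measurable_powR_expR.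
rewrite /GammaE /Rintegral fine_gt0 //; apply/andP; split.
  apply: (@lt_le_trans _ _ (\int[mu]_(x in `[1%R, 2%R]) ((2^-1 * expR (- 2)))%:E)%E).
    rewrite integral_cst // [X in (_ < _ * X)%E]lebesgue_measure_itv /= lte_fin ltr1n -EFinB -EFinM.
    by rewrite lte_fin !mulr_gt0 ?expR_gt0 // subr_gt0 ltr1n.
  apply: (@le_trans _ _ (\int[mu]_(x in `[1%R, 2%R]) (x `^ (a - 1) * expR (- x))%:E)%E).
    apply: ge0_le_integral => //.
    - exact: mg.
    move=> x; rewrite /= in_itv /= => /andP[x1 x2]; rewrite lee_fin.
    have x0 : 0 < x by exact: lt_le_trans x1.
    apply: ler_pM; rewrite ?expR_ge0 //; last by rewrite ler_expR lerN2.
    rewrite -(ler_pM2l x0) mulr_powRB1 ?(ltW x0) //.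
    apply: (@le_trans _ _ 1); first by rewrite ler_pdivrMr // mul1r.
    by rewrite -(powRr0 x) ler_powR // ltW.
  apply: ge0_subset_integral; [by []|by []|exact: mg|exact: g0|].
  by move=> x /=; rewrite !in_itv /= => /andP[x1 _]; rewrite andbT (lt_le_trans _ x1).
have -> : `]0%R, +oo[%classic = `]0%R, 1%R] `|` `]1%R, +oo[ :> set R.
  by rewrite -itv_bndbnd_setU //= bnd_simp.
rewrite ge0_integral_setU //; last 3 first.
- exact: mg.
- by move=> x; exact: g0.
- apply/disj_setPLR => x /=; rewrite !in_itv /= => /andP[_ x1] /andP[x2 _].
  by have := lt_le_trans x2 x1; rewrite ltxx.
rewrite lte_add_pinfty //.
  by apply: le_lt_trans (integral_gamma_head a0) _; rewrite ltry.
apply: le_lt_trans (integral_gamma_tail_lty a).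
apply: ge0_subset_integral; [by []|by []|exact: mg|exact: g0|].
by move=> x /=; rewrite !in_itv /= !andbT => /ltW.
Qed.

End power_integrals.

(** * The operator at the origin as a ball average *)

Section operator_identity.
Context {R : realType}.
Local Notation mu := (@lebesgue_measure R).
Local Notation T := (measurableTypeR R).

(** The density of the Haar measure dt / t of the multiplicative group of
    positive reals, extended by 0 to the whole line. *)
Definition haar_weight (t : R) : R := (0 < t)%R%:R * t `^ (- 1).

Lemma haar_weightE t : 0 < t -> haar_weight t = t^-1.
Proof. by move=> t0; rewrite /haar_weight t0 mul1r powR_inv1 // ltW. Qed.

Lemma haar_weight_eq0 t : t <= 0 -> haar_weight t = 0.
Proof. by rewrite /haar_weight leNgt => /negbTE ->; rewrite mul0r. Qed.

Lemma haar_weight_ge0 t : 0 <= haar_weight t.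
Proof. by rewrite mulr_ge0 // powR_ge0. Qed.

Lemma measurable_haar_weight : measurable_fun setT haar_weight.
Proof.
apply: measurable_funM; last exact: measurable_powR.
rewrite (_ : (fun _ => _) = \1_(`]0, +oo[%classic) :> (R -> R)).
  exact: measurable_indic.
by apply/funext => t; rewrite indicE mem_setE in_itv /= andbT.
Qed.

Lemma integral_haar_weight (f : R -> R) :
  (\int[mu]_t (f t * haar_weight t)%:E = \int[mu]_(t in `]0%R, +oo[) (f t / t)%:E)%E.
Proof.
rewrite [RHS]integral_mkcond; apply: eq_integral => t _.
rewrite patchE mem_setE in_itv /= andbT; case: ltP => t0.
  by rewrite haar_weightE.
by rewrite haar_weight_eq0 // mulr0.
Qed.

Lemma haar_dilation (f : R -> R) (c : R) : 0 < c -> measurable_fun setT f ->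
  (forall t, 0 <= f t) ->
  (\int[mu]_t (f (c * t) * haar_weight t)%:E = \int[mu]_t (f t * haar_weight t)%:E)%E.
Proof.
move=> c0 mf f0.
have mfw : measurable_fun setT (fun t => (f t * haar_weight t)%:E).
  by apply/measurable_EFinP; apply: measurable_funM => //; exact: measurable_haar_weight.
have fw0 t : (0 <= (f t * haar_weight t)%:E)%E.
  by rewrite lee_fin mulr_ge0 // haar_weight_ge0.
transitivity (\int[mu]_t (c%:E * (f (c * t + 0) * haar_weight (c * t + 0))%:E))%E.
  apply: eq_integral => t _; rewrite addr0 -EFinM [in RHS]mulrCA; congr (f _ * _)%:E.
  have [t0|t0] := ltP 0 t; last first.
    by rewrite !haar_weight_eq0 ?mulr0 // pmulr_rle0.
  rewrite !haar_weightE ?mulr_gt0 // invfM mulrA mulfV ?mul1r //.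
  by rewrite gt_eqF.
rewrite ge0_integralZl_EFin ?(ltW c0) //; last first.
  by apply: (measurableT_comp mfw); exact: measurable_affine.
rewrite (lebesgue_integral_affine 0 c0 mfw fw0) muleA -EFinM mulfV ?mul1e //.
by rewrite gt_eqF.
Qed.

Lemma haar_tail (m r : R) : 0 < m -> 0 < r ->
  (\int[mu]_t ((r <= t)%R%:R * t `^ (- m) * haar_weight t)%:E = (r `^ (- m) / m)%:E)%E.
Proof.
move=> m0 r0; rewrite -integral_powR_tail // [RHS]integral_mkcond.
apply: eq_integral => t _; rewrite patchE mem_setE in_itv /= andbT.
case: leP => [rt|_]; last by rewrite !mul0r.
have t0 : 0 < t by exact: lt_le_trans rt.
rewrite mul1r haar_weightE //; congr EFin.
by rewrite powRB ?powRr1 ?ltW //; apply/implyP => _; rewrite gt_eqF.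
Qed.

Lemma enormZ n (c : R) (y : 'cV[R]_n) : 0 <= c -> enorm (c *: y) = c * enorm y.
Proof.
move=> c0; rewrite -[RHS](ger0_norm (mulr_ge0 c0 (enorm_ge0 y))) -sqrtr_sqr exprMn.
rewrite enorm_sqr mulr_sumr; congr Num.sqrt.
by apply: eq_bigr => i _; rewrite mxE exprMn.
Qed.

Lemma op_densityZ n (s t : R) (A : 'M[R]_n.+1) y : 0 < t ->
  op_density s A (t *: y) = t `^ (2 * s) * op_density s A y.
Proof.
move=> t0; rewrite /op_density -scalemxAr mxE enormZ ?(ltW t0) // normrM (gtr0_norm t0).
rewrite !powRM ?normr_ge0 ?enorm_ge0 ?(ltW t0) // mulr2n mulrDl mul1r.
rewrite powRD; last by apply/implyP => _; rewrite gt_eqF.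
ring.
Qed.

Lemma enorm_eq0 n (y : 'cV[R]_n) : (enorm y == 0) = (y == 0).
Proof. by rewrite -sqrf_eq0 enorm_dotE dot_eq0. Qed.

Lemma enorm_gt0 n (y : 'cV[R]_n) : (0 < enorm y) = (y != 0).
Proof. by rewrite lt_neqAle enorm_ge0 andbT eq_sym enorm_eq0. Qed.

Lemma op_density0 n (s : R) (A : 'M[R]_n.+1) : s != 0 -> op_density s A 0 = 0.
Proof.
by move=> s0; rewrite /op_density mulmx0 mxE normr0 powR0 // mul0r.
Qed.

Section identity.
Variables (n : nat) (s : R) (A : 'M[R]_n.+1) (X : R -> R) (kappa : R).
Hypotheses (s0 : 0 < s) (Apd : sym_posdef A).
Hypotheses (mX : measurable_fun setT X) (X0 : forall t, 0 <= X t).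
Hypothesis Xkappa : (\int[mu]_t (X t * haar_weight t)%:E = kappa%:E)%E.

Let m : R := n.+1%:R + 2 * s.
Let m0 : 0 < m. Proof. by rewrite addr_gt0 ?mulr_gt0. Qed.

Let Aenorm_gt0 y : y != 0 -> 0 < enorm (A *m y).
Proof. by move=> y0; rewrite enorm_gt0 posdef_mul_neq0. Qed.

Let joint (y : 'cV[R]_n.+1) (t : R) : R :=
  unit_ball y * op_density s A y * (X (enorm (A *m y) * t) * haar_weight t).

Let joint_ge0 y t : 0 <= joint y t.
Proof.
rewrite /joint; apply: mulr_ge0; apply: mulr_ge0 => //.
  exact: op_density_ge0.
exact: haar_weight_ge0.
Qed.

Let joint_t y : (\int[mu]_t (joint y t)%:E =
  kappa%:E * (unit_ball y * op_density s A y)%:E)%E.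
Proof.
have [->|y0] := eqVneq y 0.
  rewrite op_density0 ?gt_eqF // mulr0 mule0 integral0_eq // => t _.
  by rewrite /joint op_density0 ?gt_eqF // mulr0 mul0r.
under eq_integral do rewrite /joint EFinM.
rewrite ge0_integralZl_EFin //.
- by rewrite haar_dilation ?Aenorm_gt0 // Xkappa muleC.
- by move=> t _; rewrite lee_fin mulr_ge0 // haar_weight_ge0.
- apply/measurable_EFinP; apply: measurable_funM; last exact: measurable_haar_weight.
  by apply: (measurableT_comp mX).
- by rewrite mulr_ge0 ?unit_ball_ge0 ?op_density_ge0.
Qed.

(* For t > 0 the substitution of y / t for y carries joint to joint'. *)
Let joint' (y : 'cV[R]_n.+1) (t : R) : R :=
  op_density s A y * X (enorm (A *m y)) *
  ((enorm y <= t)%R%:R * t `^ (- m) * haar_weight t).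

Let joint'_ge0 y t : 0 <= joint' y t.
Proof.
by rewrite !mulr_ge0 ?op_density_ge0 ?haar_weight_ge0 ?powR_ge0.
Qed.

Let joint'_t y : (\int[mu]_t (joint' y t)%:E =
  (m^-1)%:E * (op_density s A y * X (enorm (A *m y)) / enorm y `^ m)%:E)%E.
Proof.
have [->|y0] := eqVneq y 0.
  rewrite op_density0 ?gt_eqF // !mul0r mule0 integral0_eq // => t _.
  by rewrite /joint' op_density0 ?gt_eqF // !mul0r.
under eq_integral do rewrite /joint' EFinM.
rewrite ge0_integralZl_EFin //.
- rewrite haar_tail ?enorm_gt0 // -!EFinM powRN; congr EFin; ring.
- by move=> t _; rewrite lee_fin !mulr_ge0 ?powR_ge0 // haar_weight_ge0.
- apply/measurable_EFinP; apply: measurable_funM; last exact: measurable_haar_weight.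
  apply: measurable_funM; last exact: measurable_powR.
  rewrite (_ : (fun _ => _) = \1_(`[enorm y, +oo[%classic) :> (R -> R)).
    exact: measurable_indic.
  by apply/funext => t; rewrite indicE mem_setE in_itv andbT.
- by rewrite mulr_ge0 ?op_density_ge0.
Qed.

Let m_density d (Z : measurableType d) (g : Z -> 'cV[R]_n.+1) :
  (forall i, measurable_fun setT (fun z => g z i 0)) ->
  measurable_fun setT (fun z => op_density s A (g z)).
Proof. by move=> mg; exact: (colmeas_comp (colmeas_op_density s A) mg). Qed.

Let m_enorm d (Z : measurableType d) (g : Z -> 'cV[R]_n.+1) :
  (forall i, measurable_fun setT (fun z => g z i 0)) ->
  measurable_fun setT (fun z => enorm (g z)).
Proof. by move=> mg; exact: (colmeas_comp (@colmeas_enorm R n.+1) mg). Qed.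

Let mcoord i : measurable_fun setT
  (fun p : n.+1.-tuple T * T => tcol p.1 i 0 : R).
Proof. by apply: (measurableT_comp (measurable_tcol i)). Qed.

Let m_joint : measurable_fun setT (fun p : n.+1.-tuple T * T => (joint (tcol p.1) p.2)%:E).
Proof.
apply/measurable_EFinP; apply: measurable_funM.
  apply: measurable_funM; last exact: m_density mcoord.
  exact: (colmeas_comp (@colmeas_unit_ball R n.+1) mcoord).
apply: measurable_funM.
  apply: (measurableT_comp mX); apply: measurable_funM => //.
  by apply: (m_enorm (g := fun p => A *m tcol p.1)) => i; apply: measurable_mulmx => j; exact: mcoord.
by apply: (measurableT_comp measurable_haar_weight).
Qed.

Let m_joint' : measurable_fun setT (fun p : n.+1.-tuple T * T => (joint' (tcol p.1) p.2)%:E).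
Proof.
apply/measurable_EFinP; apply: measurable_funM.
  apply: measurable_funM; first exact: m_density mcoord.
  apply: (measurableT_comp mX).
  by apply: (m_enorm (g := fun p => A *m tcol p.1)) => i; apply: measurable_mulmx => j; exact: mcoord.
apply: measurable_funM; last by apply: (measurableT_comp measurable_haar_weight).
apply: measurable_funM; last by apply: (measurableT_comp (measurable_powR _)).
rewrite (_ : (fun _ => _) = fun p : n.+1.-tuple T * T => ((enorm (tcol p.1) - p.2 <= 0)%R)%:R : R).
  apply: (measurableT_comp (measurable_indic_le 0)).
  by apply: measurable_funB => //; exact: m_enorm mcoord.
by apply/funext => p; rewrite subr_le0.
Qed.

Let joint_joint' t :
  intRn (fun y => (joint y t)%:E) = intRn (fun y => (joint' y t)%:E).
Proof.
have [t0|t0] := ltP 0 t; last first.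
  apply: eq_intRn => y; congr EFin.
  by rewrite /joint /joint' haar_weight_eq0 // !mulr0.
have mj : colmeas (fun y => (joint' y t)%:E).
  by apply: (measurableT_comp m_joint' (pair2_measurable t)).
have H := intRn_scale t0 mj (fun y => joint'_ge0 y t).
have tn : 0 < t ^- n.+1 by rewrite invr_gt0 exprn_gt0.
transitivity (intRn (fun y => ((t ^+ n.+1)%:E * (joint' (t *: y) t)%:E)%E)).
  apply: eq_intRn => y; rewrite -EFinM; congr EFin.
  rewrite /joint /joint' op_densityZ // -scalemxAr !enormZ ?(ltW t0) //.
  rewrite /unit_ball ger_pMr // (mulrC t (enorm _)).
  rewrite powRN /m powRD; last by apply/implyP => _; rewrite gt_eqF.
  rewrite powR_mulrn ?(ltW t0) //.
  have t1 : t ^+ n.+1 != 0 by rewrite gt_eqF // exprn_gt0.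
  have t2 : t `^ (2 * s) != 0 by rewrite gt_eqF // powR_gt0.
  by field; rewrite t1 t2.
rewrite intRnZ ?exprn_ge0 ?(ltW t0) //.
- by rewrite H muleA -EFinM mulfV ?mul1e // gt_eqF // exprn_gt0.
- exact: colmeas_scale mj.
- by move=> y; rewrite lee_fin.
Qed.

(** Integrate [joint] over [y] and [t].  In [t], invariance of the Haar measure
    removes the factor |A y| from the argument of [X] and leaves [kappa] times
    the ball average.  In [y], for fixed [t], a dilation by [t] moves [t] from the
    argument of [X] to the condition |y| <= t, by homogeneity of degree 2 s, and
    then the integral over t >= |y| of t^(-m) dt / t is |y|^(-m) / m.  This
    replaces the computation in polar coordinates. *)
Theorem ball_average_identity :
  (intRn (fun y => (op_density s A y * X (enorm (A *m y)) / enorm y `^ m)%R%:E) =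
   (m * kappa)%:E * ball_int (op_density s A))%E.
Proof.
have mBO := colmeas_ball (colmeas_op_density s A).
have BO0 y : (0 <= (unit_ball y * op_density s A y)%:E)%E.
  by rewrite lee_fin mulr_ge0 ?unit_ball_ge0 ?op_density_ge0.
have k0 : 0 <= kappa.
  rewrite -lee_fin -Xkappa; apply: integral_ge0 => t _.
  by rewrite lee_fin mulr_ge0 // haar_weight_ge0.
have E1 : (kappa%:E * ball_int (op_density s A) =
    intRn (fun y => \int[mu]_t (joint y t)%:E))%E.
  rewrite /ball_int -(intRnZ mBO BO0 k0).
  by apply: eq_intRn => y; rewrite joint_t.
have E2 : intRn (fun y => \int[mu]_t (joint y t)%:E)%E =
    intRn (fun y => \int[mu]_t (joint' y t)%:E)%E.
  rewrite /intRn (fubini_tonelli (m1 := lebesgue_tuple R n.+1) (m2 := mu) _ m_joint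
    (fun p => joint_ge0 _ _)).
  rewrite [RHS](fubini_tonelli (m1 := lebesgue_tuple R n.+1) (m2 := mu) _ m_joint'
    (fun p => joint'_ge0 _ _)).
  by apply: eq_integral => t _; exact: joint_joint'.
have mden : colmeas (fun y => (op_density s A y * X (enorm (A *m y)) / enorm y `^ m)%:E).
  apply: colmeas_EFin; apply: colmeasM.
    apply: colmeasM; first exact: colmeas_op_density.
    apply: (measurableT_comp mX).
    exact: (colmeas_mulmx A (@colmeas_enorm R n.+1)).
  rewrite (_ : (fun _ => _) = fun y : 'cV[R]_n.+1 => enorm y `^ (- m)).
    by apply: colmeas_powR; exact: colmeas_enorm.
  by apply/funext => y; rewrite powRN.
have E3 : intRn (fun y => \int[mu]_t (joint' y t)%:E)%E = ((m^-1)%:E *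
   intRn (fun y => (op_density s A y * X (enorm (A *m y)) / enorm y `^ m)%:E))%E.
  rewrite -intRnZ; [|exact: mden| |by rewrite invr_ge0 ltW].
    by apply: eq_intRn => y; rewrite joint'_t.
  by move=> y; rewrite lee_fin !mulr_ge0 ?op_density_ge0 ?invr_ge0 ?powR_ge0.
have m1 : m != 0 by rewrite gt_eqF.
by rewrite EFinM -muleA E1 E2 E3 muleA -EFinM mulfV // mul1e.
Qed.

End identity.

End operator_identity.

(** * The function u *)

Section test_function.
Context {R : realType}.
Local Notation mu := (@lebesgue_measure R).

Lemma continuous_norm_powR (s : R) : 0 < s -> continuous (fun x : R => `|x| `^ s).
Proof.
move=> s0 x; have [->|x0] := eqVneq x 0; last first.
  apply: (@continuous_comp _ _ _ (fun x : R => `|x|) (@powR R ^~ s)).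
    exact: norm_continuous.
  by apply: continuous_powR; rewrite normr_gt0.
rewrite /continuous_at normr0 powR0 ?gt_eqF //.
apply/cvgr0Pnorm_lt => e e0; near=> y.
rewrite ger0_norm ?powR_ge0 //.
have -> : e = (e `^ s^-1) `^ s.
  by rewrite -powRrM mulVf ?gt_eqF // powRr1 // ltW.
apply: gt0_ltr_powR => //; rewrite ?nnegrE ?powR_ge0 //.
near: y; apply/nbhs_ballP; exists (e `^ s^-1); first by rewrite /= powR_gt0.
by move=> y; rewrite /ball /= sub0r normrN.
Unshelve. all: by end_near. Qed.

Lemma continuous_mul (T : topologicalType) (f g : T -> R) (x : T) :
  {for x, continuous f} -> {for x, continuous g} ->
  {for x, continuous (fun y => f y * g y)}.
Proof. by move=> cf cg; exact: (continuousM cf cg). Qed.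

Lemma continuous_sum (T : topologicalType) (I : Type) (r : seq I) (F : I -> T -> R) :
  (forall i, continuous (F i)) -> continuous (fun y => \sum_(i <- r) F i y).
Proof.
move=> cF; elim: r => [|i r IH].
  rewrite (_ : (fun _ => _) = cst 0); first exact: cst_continuous.
  by apply/funext => y; rewrite big_nil.
rewrite (_ : (fun _ => _) = F i \+ (fun y => \sum_(j <- r) F j y)); last first.
  by apply/funext => y; rewrite big_cons.
by move=> y; apply: cvgD; [exact: cF|exact: IH].
Qed.

Lemma coordinate_continuous n (i : 'I_n) : continuous ((fun y => y i 0) : 'cV[R]_n -> R).
Proof. exact: coord_continuous. Qed.

Lemma enorm_continuous n : continuous (@enorm R n).
Proof.
move=> y; apply: (@continuous_comp _ _ _ (fun y : 'cV[R]_n => \sum_i y i 0 ^+ 2) Num.sqrt).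
  apply: continuous_sum => i z.
  rewrite (_ : (fun _ => _) = fun y : 'cV[R]_n => y i 0 * y i 0).
    apply: (@continuous_mul _ (fun y : 'cV[R]_n => y i 0) (fun y : 'cV[R]_n => y i 0) z).
      exact: coordinate_continuous.
    exact: coordinate_continuous.
  by apply/funext => y'; rewrite expr2.
exact: sqrt_continuous.
Qed.

Lemma trmx_continuous m n : continuous (@trmx R m n).
Proof.
move=> /= M s /= /(nbhs_ballP (M^T)) [e e0 es].
apply/nbhs_ballP; exists e => //= N [_ MN]; apply: es; split => // i j.
by rewrite !mxE; exact: MN.
Qed.

(** The product of segments is compact for rows; transposition carries it to
    columns, where it contains the ball as a closed subset. *)
Lemma enorm_ball_compact n (K : R) : compact [set y : 'cV[R]_n | enorm y <= K].
Proof.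
have tK (y : 'cV[R]_n) : enorm y <= K -> forall i, y^T ord0 i \in `[- K, K].
  move=> yK i; rewrite in_itv /= mxE -ler_norml.
  by apply: le_trans yK; rewrite (_ : ord0 = 0) //; exact: coord_le_enorm.
pose C : set 'rV[R]_n := [set v | forall i, v ord0 i \in `[- K, K]].
have cC : compact C.
  apply: (@rV_compact _ _ (fun=> `[- K, K]%classic)) => _; exact: segment_compact.
have cT : compact (@trmx R 1 n @` C).
  by apply: continuous_compact => //; apply: continuous_subspaceT; exact: trmx_continuous.
apply: subclosed_compact cT _.
  rewrite (_ : mkset _ = @enorm R n @^-1` [set r | r <= K]) //.
  apply: closed_comp; last exact: closed_le.
  by move=> y _; exact: enorm_continuous.
move=> y /= yK; exists y^T; last by rewrite trmxK.
by move=> i; exact: tK.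
Qed.

Section profile.
Variables (s rho : R) (chi : R -> R).
Hypotheses (s01 : 0 < s < 1) (hrho : admissible_radius s rho).
Hypothesis (hchi : admissible_profile s rho chi).

Let s0 : 0 < s. Proof. by case/andP: s01. Qed.
Let rho0 : 0 < rho. Proof. by case: hrho => /andP[]. Qed.

(** [chi] is only constrained on the half-line; its even extension is continuous
    and measurable on the whole line. *)
Definition profile (t : R) : R := chi `|t|.

Lemma profile_ge0 t : 0 <= profile t.
Proof. by case: hchi => _ c0 _ _; exact: c0. Qed.

Lemma profile_small t : `|t| <= rho -> profile t = t ^+ 2.
Proof.
move=> tr; case: hchi => _ _ c2 _.
by rewrite /profile c2 ?tr ?andbT // real_normK // num_real.
Qed.

Lemma profile_continuous : continuous profile.
Proof.
case: hchi => -[cc _] _ _ _; move=> x; have [->|x0] := eqVneq x 0; last first.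
  apply: (@continuous_comp _ _ _ (fun x : R => `|x|) chi); first exact: norm_continuous.
  have /continuous_within_itvcyP[cc' _] := cc.
  by apply: cc'; rewrite in_itv /= andbT normr_gt0.
have p0 : profile 0 = 0 * 0 by rewrite profile_small ?normr0 ?(ltW rho0) // expr2.
rewrite /continuous_at p0.
apply: (@cvg_trans _ ((fun x : R => x * x) @ (0 : R))); last first.
  exact: (continuous_mul (f := id) (g := id) (x := 0 : R) cvg_id cvg_id).
apply: near_eq_cvg; near=> t.
have tr : `|t| <= rho.
  near: t; apply/nbhs_ballP; exists rho => //= t.
  by rewrite /ball /= sub0r normrN => /ltW.
by rewrite profile_small // expr2.
Unshelve. all: by end_near. Qed.

Lemma profile_support : exists2 K : R, 0 < K & forall t, K < `|t| -> profile t = 0.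
Proof.
case: hchi => -[_ /compact_bounded [M [_ Mb]]] _ _ _.
exists (`|M| + 1); first by rewrite ltr_pwDr.
move=> t Kt; apply/eqP/negPn/negP => ct.
have M1 : M < `|M| + 1 by rewrite (le_lt_trans (ler_norm _)) // ltrDl.
have tcl : closure (`[0, +oo[%classic `&` [set x | chi x != 0]) `|t|.
  by apply: subset_closure; split => //=; rewrite in_itv /= andbT.
by have := Mb _ M1 _ tcl; rewrite /= normr_id leNgt Kt.
Qed.

(** The normalisation of [chi] prescribes the value of its integral against
    dt / t. *)
Definition profile_mass : R := (4 * (1 - s))^-1.

Lemma profile_integral :
  (\int[mu]_t (profile t * haar_weight t)%:E = profile_mass%:E)%E.
Proof.
case: hchi => _ _ _ h.
have s1 : 0 < 4 * (1 - s) by rewrite mulr_gt0 // subr_gt0; case/andP: s01.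
rewrite integral_haar_weight.
transitivity (\int[mu]_(t in `]0%R, +oo[) (chi t / t)%:E)%E.
  apply: eq_integral => t; rewrite inE /= in_itv /= andbT => t0.
  by rewrite /profile gtr0_norm.
move: h => /(congr1 (fun x => (4 * (1 - s))^-1%:E * x)%E).
by rewrite muleA -EFinM mulVf ?gt_eqF // mul1e mule1.
Qed.

Section u.
Variables (n : nat).
Local Notation u := (u_chi (ord0 : 'I_n.+1) s chi).

Lemma u_chiE y : u y = `|y ord0 0| `^ s * enorm y `^ s * profile (enorm y).
Proof. by rewrite /u_chi /profile (ger0_norm (enorm_ge0 y)). Qed.

Lemma u_chi0 : u 0 = 0.
Proof. by rewrite u_chiE mxE normr0 powR0 ?gt_eqF // !mul0r. Qed.

Lemma u_chiN y : u (- y) = u y.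
Proof.
have en : enorm (- y) = enorm y.
  by congr Num.sqrt; apply: eq_bigr => i _; rewrite mxE sqrrN.
by rewrite !u_chiE en mxE normrN.
Qed.

Lemma u_second_diff y : second_diff u 0 y = 2 * u y.
Proof. by rewrite /second_diff add0r sub0r u_chiN u_chi0 mulr0 subr0 mulr2n mulrDl mul1r. Qed.

Lemma u_continuous : continuous u.
Proof.
have -> : u = (fun y => (`|y ord0 0| `^ s * `|enorm y| `^ s) * profile (enorm y)).
  by apply/funext => y; rewrite u_chiE (ger0_norm (enorm_ge0 y)).
have c1 : continuous (fun y : 'cV[R]_n.+1 => `|y ord0 0| `^ s).
  move=> y; apply: (@continuous_comp _ _ _ (fun y : 'cV[R]_n.+1 => y ord0 0)
    (fun x => `|x| `^ s)); first exact: coord_continuous.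
  exact: continuous_norm_powR.
have c2 : continuous (fun y : 'cV[R]_n.+1 => `|enorm y| `^ s).
  move=> y; apply: (@continuous_comp _ _ _ (@enorm R n.+1) (fun x => `|x| `^ s)).
    exact: enorm_continuous.
  exact: continuous_norm_powR.
have c3 : continuous (fun y : 'cV[R]_n.+1 => profile (enorm y)).
  move=> y; apply: (@continuous_comp _ _ _ (@enorm R n.+1) profile).
    exact: enorm_continuous.
  exact: profile_continuous.
by move=> y; exact: (continuous_mul (continuous_mul (c1 y) (c2 y)) (c3 y)).
Qed.

Lemma u_Cc : Cc_on setT u.
Proof.
split; first by apply: continuous_subspaceT; exact: u_continuous.
have [K K0 hK] := profile_support.
apply: (subclosed_compact (B := [set y : 'cV[R]_n.+1 | enorm y <= K])).
- exact: closed_closure.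
- exact: enorm_ball_compact.
rewrite -[X in _ `<=` X](_ : closure [set y : 'cV[R]_n.+1 | enorm y <= K] = _).
  apply: closure_subset => y [_ /=]; apply: contraR; rewrite -ltNge => Ky.
  by rewrite u_chiE hK ?mulr0 // ger0_norm ?enorm_ge0.
apply/esym/closure_id; rewrite (_ : mkset _ = @enorm R n.+1 @^-1` [set r | r <= K]) //.
apply: closed_comp; last exact: closed_le.
by move=> y _; exact: enorm_continuous.
Qed.

Lemma is_derive_dot (y v : 'cV[R]_n.+1) :
  is_derive y v (fun y : 'cV[R]_n.+1 => dot y y) (2 * dot v y).
Proof.
have cv : (fun h : R => h^-1 *: (((fun y => dot y y) \o shift y) (h *: v) - dot y y)) @ 0^'
    --> 2 * dot v y.
  apply: (@cvg_trans _ ((fun h : R => h * dot v v + 2 * dot v y) @ 0^')).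
    apply: near_eq_cvg; near=> h.
    have h0 : h != 0 by near: h; exact: nbhs_dnbhs_neq.
    rewrite /= !dotDl !dotDr !dotZl !dotZr (dotC y v) /GRing.scale /=.
    by field.
  have c0 : {for 0 : R, continuous (fun h : R => h * dot v v + 2 * dot v y)}.
    apply: cvgD; last exact: cvg_cst.
    by apply: (continuous_mul (f := id)); [exact: cvg_id|exact: cvg_cst].
  move: c0; rewrite /prop_for /continuous_at /= mul0r add0r => c0.
  by apply: cvg_trans c0; apply: cvg_fmap2; exact: nbhs_dnbhs.
split; first by apply/cvg_ex; exists (2 * dot v y).
exact: cvg_lim.
Unshelve. all: by end_near. Qed.

Lemma is_derive_coord2 (i : 'I_n.+1) (y v : 'cV[R]_n.+1) :
  is_derive y v (fun y : 'cV[R]_n.+1 => 2 * y i 0) (2 * v i 0).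
Proof.
have cv : (fun h : R => h^-1 *: (((fun y : 'cV[R]_n.+1 => 2 * y i 0) \o shift y) (h *: v)
    - 2 * y i 0)) @ 0^' --> 2 * v i 0.
  apply: (@cvg_trans _ ((fun h : R => 2 * v i 0) @ 0^')); last exact: cvg_cst.
  apply: near_eq_cvg; near=> h.
  have h0 : h != 0 by near: h; exact: nbhs_dnbhs_neq.
  by rewrite /= !mxE /GRing.scale /=; field.
split; first by apply/cvg_ex; exists (2 * v i 0).
exact: cvg_lim.
Unshelve. all: by end_near. Qed.

Lemma partial_dot (i : 'I_n.+1) :
  partial i (fun y : 'cV[R]_n.+1 => dot y y) = (fun y => 2 * y i 0).
Proof.
apply/funext => y; rewrite /partial.
by rewrite (@derive_val _ _ _ _ _ _ _ (is_derive_dot y _)) dot_delta.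
Qed.

(** The comparison function is |y|^2: on |y| < rho <= 1 the function u is
    |y_1|^s |y|^s |y|^2, and |y_1|^s |y|^s < 1. *)
Lemma u_touched : touched_from_above_C2 u 0.
Proof.
have rho1 : rho <= 1 by case: hrho => /andP[].
exists [set y | enorm y < rho], (fun y => dot y y); split.
- rewrite (_ : mkset _ = @enorm R n.+1 @^-1` [set r | r < rho]) //.
  apply: open_comp; last exact: open_lt.
  by move=> y _; exact: enorm_continuous.
- by rewrite /= (_ : enorm 0 = 0) //; apply/eqP; rewrite enorm_eq0.
- split.
    move=> i y _; split; first exact: (@ex_derive _ _ _ _ _ _ _ (is_derive_dot y _)).
    rewrite partial_dot.
    have c2 : continuous (fun _ : 'cV[R]_n.+1 => 2 : R) by exact: cst_continuous.
    apply: (@continuous_mul _ (fun=> 2) (fun y : 'cV[R]_n.+1 => y i 0) y); first exact: c2.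
    exact: coordinate_continuous.
  move=> i; rewrite partial_dot => j y _; split.
    exact: (@ex_derive _ _ _ _ _ _ _ (is_derive_coord2 i y _)).
  rewrite (_ : partial j _ = cst (2 * (delta_mx j 0 : 'cV[R]_n.+1) i 0)).
    exact: cst_continuous.
  apply/funext => z.
  exact: (@derive_val _ _ _ _ _ _ _ (is_derive_coord2 i z _)).
- by rewrite u_chi0; apply/eqP; rewrite dot_eq0.
move=> y /= yr y0.
have e0 : 0 < enorm y by rewrite enorm_gt0.
have e1 : enorm y < 1 by exact: lt_le_trans rho1.
rewrite u_chiE profile_small; last by rewrite ger0_norm ?enorm_ge0 // ltW.
rewrite -enorm_dotE -[ltRHS]mul1r ltr_pM2r ?exprn_gt0 //.
have h1 : `|y ord0 0| `^ s <= 1.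
  have -> : 1 = 1 `^ s :> R by rewrite powR1.
  rewrite ge0_ler_powR ?nnegrE ?(ltW s0) //.
  by apply: le_trans (coord_le_enorm _ _) _; exact: ltW.
have h2 : enorm y `^ s < 1.
  have -> : 1 = 1 `^ s :> R by rewrite powR1.
  by rewrite gt0_ltr_powR ?nnegrE ?enorm_ge0.
apply: le_lt_trans h2; rewrite ler_piMl ?powR_ge0 //.
Qed.

Let s1 : 0 < 4 * (1 - s).
Proof. by rewrite mulr_gt0 // subr_gt0; case/andP: s01. Qed.

Lemma profile_mass_gt0 : 0 < profile_mass.
Proof. by rewrite invr_gt0. Qed.

Lemma measurable_profile : measurable_fun setT profile.
Proof. exact: (continuous_measurable_fun profile_continuous). Qed.

(** The constant is assembled from [C_const / 2], the factor 2 of the second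
    difference, and the dimension factor of [ball_average_identity]. *)
Lemma L_op_eq (A : 'M[R]_n.+1) : sym_posdef A ->
  L_op s A u 0 = ((@C_const R n.+1 s * ((n.+1%:R + 2 * s) * profile_mass))%:E *
    ball_int (op_density s A))%E.
Proof.
move=> Apd; rewrite /L_op.
have -> : integral_Rn (fun y => second_diff u 0 (A *m y) / enorm y `^ (n.+1%:R + 2 * s)) =
    (2%:E * intRn (fun y => (op_density s A y * profile (enorm (A *m y)) /
      enorm y `^ (n.+1%:R + 2 * s))%:E))%E.
  transitivity (intRn (fun y : 'cV[R]_n.+1 =>
    (second_diff u 0 (A *m y) / enorm y `^ (n.+1%:R + 2 * s))%:E)); first by [].
  rewrite -intRnZ //.
  - apply: eq_intRn => y; rewrite u_second_diff u_chiE -EFinM; congr EFin.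
    by rewrite /op_density -!mulrA.
  - apply: colmeas_EFin; apply: colmeasM.
      apply: colmeasM; first exact: colmeas_op_density.
      apply: (measurableT_comp measurable_profile).
      exact: (colmeas_mulmx A (@colmeas_enorm R n.+1)).
    rewrite (_ : (fun _ => _) = fun y : 'cV[R]_n.+1 => enorm y `^ (- (n.+1%:R + 2 * s))).
      by apply: colmeas_powR; exact: colmeas_enorm.
    by apply/funext => y; rewrite powRN.
  - move=> y; rewrite lee_fin; apply: mulr_ge0; last by rewrite invr_ge0 powR_ge0.
    by apply: mulr_ge0; [exact: op_density_ge0|exact: profile_ge0].
rewrite (ball_average_identity s0 Apd measurable_profile profile_ge0 profile_integral).
rewrite !muleA -!EFinM; congr (_%:E * _)%E.
by field.
Qed.

Lemma C_const_gt0 : 0 < @C_const R n.+1 s.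
Proof.
have s1' : 0 < 1 - s by rewrite subr_gt0; case/andP: s01.
rewrite /C_const divr_gt0 //.
  rewrite !mulr_gt0 ?powR_gt0 // GammaE_gt0 // divr_gt0 // addr_gt0 // mulr_gt0 //.
by rewrite mulr_gt0 ?powR_gt0 ?pi_gt0 // GammaE_gt0.
Qed.

Lemma lebesgue_integralN (f : R -> \bar R) : measurable_fun setT f ->
  (forall x, (0 <= f x)%E) -> (\int[mu]_x f (- x)%R = \int[mu]_x f x)%E.
Proof.
move=> mf f0.
rewrite [RHS](@eq_measure_integral _ _ _ _
  (pushforward mu (-%R : _ -> measurableTypeR R))); last first.
  by move=> B mB _; exact/esym/lebesgue_measureN.
rewrite (@ge0_integral_pushforward _ _ (measurableTypeR R) (measurableTypeR R) R) //.
Qed.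

(** On the line through [e] the powers of |r| cancel, and both half-lines
    contribute 2 |e_1|^s [profile_mass]. *)
Lemma Theta_op_eq (e : 'cV[R]_n.+1) : enorm e = 1 ->
  Theta_op s u 0 e = (`|e ord0 0| `^ s)%:E.
Proof.
move=> e1; set c := `|e ord0 0| `^ s.
have c0 : 0 <= c by exact: powR_ge0.
pose g (r : R) := (profile r * haar_weight r)%:E.
have g0 r : (0 <= g r)%E by rewrite lee_fin mulr_ge0 ?haar_weight_ge0 // profile_ge0.
have mg : measurable_fun setT g.
  apply/measurable_EFinP; apply: measurable_funM; first exact: measurable_profile.
  exact: measurable_haar_weight.
have mgN : measurable_fun setT (fun r : R => g (- r)) by apply: (measurableT_comp mg).
rewrite /Theta_op.
have -> : (\int[mu]_r (second_diff u 0 (r *: e) / `|r| `^ (1 + 2 * s))%:E =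
    \int[mu]_r ((2 * c)%:E * (g r + g (- r)%R)))%E.
  apply: eq_integral => r _; rewrite u_second_diff u_chiE.
  have -> : enorm (r *: e) = `|r|.
    apply/eqP; rewrite -(@eqrXn2 _ 2) ?enorm_ge0 // enorm_dotE dotZl dotZr -enorm_dotE e1.
    by rewrite expr1n mulr1 real_normK ?num_real // expr2.
  rewrite mxE normrM powRM // -/c -EFinD -EFinM; congr EFin.
  have pN : profile (- r) = profile r by rewrite /profile normrN.
  have pn : profile `|r| = profile r by rewrite /profile normr_id.
  rewrite pN pn -mulrDr.
  have [->|r0] := eqVneq r 0.
    by rewrite normr0 powR0 ?gt_eqF // !(mul0r, mulr0) oppr0 haar_weight_eq0 // addr0 !mulr0.
  have hw : haar_weight r + haar_weight (- r) = `|r|^-1.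
    move: (r0); rewrite neq_lt => /orP[rn|rp].
      by rewrite haar_weight_eq0 ?ltW // haar_weightE ?oppr_gt0 // add0r ltr0_norm.
    by rewrite haar_weightE // haar_weight_eq0 ?oppr_le0 ?ltW // addr0 gtr0_norm.
  rewrite hw powRD; last by apply/implyP => _; rewrite normr_eq0.
  rewrite powRr1 // (_ : 2 * s = s + s); last by ring.
  rewrite powRD; last by apply/implyP => _; rewrite normr_eq0.
  have nr : `|r| != 0 by rewrite normr_eq0.
  have ns : `|r| `^ s != 0 by rewrite gt_eqF // powR_gt0 // normr_gt0.
  by field; rewrite nr ns.
rewrite ge0_integralZl_EFin //; last 3 first.
- by move=> r _; rewrite adde_ge0.
- exact: emeasurable_funD.
- by rewrite mulr_ge0.
rewrite ge0_integralD // lebesgue_integralN // -/mu.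
rewrite (_ : (\int[mu]_x g x)%E = profile_mass%:E); last exact: profile_integral.
rewrite -EFinD -!EFinM; congr EFin; rewrite /profile_mass.
have s1' : 1 - s != 0 by rewrite subr_eq0 gt_eqF //; case/andP: s01.
by field.
Qed.

Lemma Theta_op_bounds (e : 'cV[R]_n.+1) : enorm e = 1 ->
  (0 <= Theta_op s u 0 e)%E /\ (Theta_op s u 0 e <= 1)%E.
Proof.
move=> e1; rewrite Theta_op_eq // !lee_fin powR_ge0; split => //.
have -> : 1 = 1 `^ s :> R by rewrite powR1.
rewrite ge0_ler_powR ?nnegrE ?(ltW s0) //.
by rewrite -e1 coord_le_enorm.
Qed.

End u.
End profile.

Lemma exists_radius (s : R) : 0 < s < 1 -> exists rho : R, admissible_radius s rho.
Proof.
move=> /andP[s0 s1]; exists 2^-1; split; first by apply/andP; split; lra.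
have s1' : 0 < 2 * (1 - s) by lra.
by rewrite ltr_pdivlMr //; nra.
Qed.

(** The graph rises along the diagonal up to [rho], then decreases linearly to
    0 at [b]. *)
Definition tent (rho b t : R) : R := Num.max 0 (Num.min t (rho * (b - t) / (b - rho))).

Section tent.
Variables (rho b : R).
Hypotheses (rho0 : 0 < rho) (rhob : rho < b).

Let br : 0 < b - rho. Proof. by rewrite subr_gt0. Qed.

Lemma tent_up t : 0 <= t <= rho -> tent rho b t = t.
Proof.
move=> /andP[t0 tr]; rewrite /tent min_l ?max_r // ler_pdivlMr // -subr_ge0.
rewrite (_ : _ - _ = b * (rho - t)); last by ring.
by rewrite mulr_ge0 ?subr_ge0 // ltW // (lt_trans rho0).
Qed.

Lemma tent_down t : rho <= t <= b -> tent rho b t = rho * (b - t) / (b - rho).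
Proof.
move=> /andP[rt tb]; rewrite /tent min_r ?max_r //.
  by rewrite divr_ge0 ?(ltW br) // mulr_ge0 ?(ltW rho0) // subr_ge0.
rewrite ler_pdivrMr // -subr_ge0 (_ : _ - _ = b * (t - rho)); last by ring.
by rewrite mulr_ge0 ?subr_ge0 // ltW // (lt_trans rho0).
Qed.

Lemma tent_out t : b <= t -> tent rho b t = 0.
Proof.
move=> bt; rewrite /tent max_l // ge_min; apply/orP; right.
by rewrite ler_pdivrMr // mul0r pmulr_rle0 // subr_le0.
Qed.

Lemma tent_continuous : continuous (tent rho b).
Proof.
have c1 : continuous (fun t : R => rho * (b - t) / (b - rho)).
  move=> t; apply: cvgM; last exact: cvg_cst.
  apply: cvgM; first exact: cvg_cst.
  by apply: cvgB; [exact: cvg_cst|exact: cvg_id].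
have -> : tent rho b = (cst 0 : R -> R^o) \max
    ((id : R -> R^o) \min (fun t => rho * (b - t) / (b - rho))) by [].
move=> t; apply: continuous_max; first exact: cst_continuous.
by apply: continuous_min; [exact: cvg_id|exact: c1].
Qed.

Lemma integral_linear (p q x y : R) : x < y ->
  (\int[mu]_(t in `[x, y]) (p * t + q)%:E =
   (p * (y ^+ 2 - x ^+ 2) / 2 + q * (y - x))%:E)%E.
Proof.
move=> xy; pose F (t : R) : R := (p / 2) * t ^+ 2 + q * t.
have dF (t : R) : is_derive t 1 F (p * t + q).
  rewrite /F; apply: is_derive_eq.
  by rewrite /GRing.scale /=; field.
have cF : continuous F.
  move=> t; apply: differentiable_continuous; apply/derivable1_diffP.
  exact: (@ex_derive _ _ _ _ _ _ _ (dF t)).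
rewrite (@continuous_FTC2 _ (fun t => p * t + q) F) //.
- by rewrite -EFinB; congr EFin; rewrite /F; field.
- apply: continuous_subspaceT => t; apply: cvgD; last exact: cvg_cst.
  by apply: cvgM; [exact: cvg_cst|exact: cvg_id].
- split.
  + by move=> t _; exact: (@ex_derive _ _ _ _ _ _ _ (dF t)).
  + by apply: cvg_at_right_filter; exact: cF.
  + by apply: cvg_at_left_filter; exact: cF.
- by move=> t _; rewrite derive1E (@derive_val _ _ _ _ _ _ _ (dF t)).
Qed.

Lemma integral_tent :
  (\int[mu]_(t in `]0%R, +oo[) (tent rho b t)%:E = (rho * b / 2)%:E)%E.
Proof.
have t0 t : 0 <= tent rho b t by rewrite /tent le_max lexx.
have mt (D : set R) : measurable_fun D (fun t => (tent rho b t)%:E).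
  apply/measurable_EFinP; apply: (@measurable_funS _ _ _ _ setT) => //.
  exact: continuous_measurable_fun tent_continuous.
have -> : `]0%R, +oo[%classic = (`]0%R, rho] `|` `]rho, b]) `|` `]b, +oo[ :> set R.
  rewrite -itv_bndbnd_setU ?bnd_simp ?(ltW rho0) ?(ltW rhob) //.
  by rewrite -itv_bndbnd_setU ?bnd_simp // ltW // (lt_trans rho0).
have mtR (D : set R) : measurable_fun D (tent rho b).
  by apply/measurable_EFinP; exact: mt.
have I1 : (\int[mu]_(t in `]0%R, rho]) (tent rho b t)%:E = (rho ^+ 2 / 2)%:E)%E.
  rewrite integral_itv_obnd_cbnd; last exact: mt.
  transitivity (\int[mu]_(t in `[0%R, rho]) (1 * t + 0)%:E)%E.
    apply: eq_integral => t; rewrite inE /= in_itv /= => tr.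
    by rewrite tent_up // mul1r addr0.
  by rewrite integral_linear //; congr EFin; ring.
have I2 : (\int[mu]_(t in `]rho, b]) (tent rho b t)%:E = (rho * (b - rho) / 2)%:E)%E.
  rewrite integral_itv_obnd_cbnd; last exact: mt.
  transitivity (\int[mu]_(t in `[rho, b])
      (- (rho / (b - rho)) * t + rho * b / (b - rho))%:E)%E.
    apply: eq_integral => t; rewrite inE /= in_itv /= => tr.
    by rewrite tent_down //; congr EFin; field; rewrite gt_eqF.
  by rewrite integral_linear //; congr EFin; field; rewrite gt_eqF.
have I3 : (\int[mu]_(t in `]b, +oo[) (tent rho b t)%:E = 0)%E.
  apply: integral0_eq => t; rewrite /= in_itv /= andbT => bt.
  by rewrite tent_out // ltW.
rewrite ge0_integral_setU; [| | | | |]; first last.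
- apply/disj_setPLR => t [|] /=; rewrite !in_itv /= => /andP[_ tb] /andP[bt _].
    by have := lt_trans rhob (lt_le_trans bt tb); rewrite ltxx.
  by have := lt_le_trans bt tb; rewrite ltxx.
- by move=> t _; rewrite lee_fin.
- exact: mt.
- exact: measurable_itv.
- by apply: measurableU; exact: measurable_itv.
rewrite ge0_integral_setU; [| | | | |]; first last.
- apply/disj_setPLR => t /=; rewrite !in_itv /= => /andP[_ tb] /andP[bt _].
  by have := lt_le_trans bt tb; rewrite ltxx.
- by move=> t _; rewrite lee_fin.
- exact: mt.
- exact: measurable_itv.
- exact: measurable_itv.
by rewrite I1 I2 I3 adde0 -EFinD; congr EFin; field.
Qed.

End tent.

(** The profile is [t * tent rho b t], for which the integral of chi(t) / t is
    the area [rho b / 2] of the tent.  The normalisation determines [b], and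
    [rho < b] is the condition on [rho]. *)
Lemma exists_profile (s rho : R) : 0 < s < 1 -> admissible_radius s rho ->
  exists chi : R -> R, admissible_profile s rho chi.
Proof.
move=> /andP[s0 s1] [/andP[rho0 rho1] rhos].
pose b := (2 * (1 - s) * rho)^-1.
have s1' : 0 < 2 * (1 - s) by lra.
have b0 : 0 < b by rewrite invr_gt0 mulr_gt0.
have rhob : rho < b.
  rewrite /b -div1r ltr_pdivlMr ?mulr_gt0 ?subr_gt0 //.
  move: rhos; rewrite ltr_pdivlMr // expr2 => h.
  by rewrite (_ : rho * (2 * (1 - s) * rho) = rho * rho * (2 * (1 - s))) //; ring.
have t0 t : 0 <= tent rho b t by rewrite /tent le_max lexx.
exists (fun t => t * tent rho b t); split.
- split.
    apply: continuous_subspaceT => t; apply: cvgM; first exact: cvg_id.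
    exact: tent_continuous.
  apply: (subclosed_compact (B := `[0, b]%classic)).
  + exact: closed_closure.
  + exact: segment_compact.
  rewrite -[X in _ `<=` X](_ : closure `[0, b]%classic = _); last first.
    by apply/esym/closure_id; exact: interval_closed.
  apply: closure_subset => t [/=]; rewrite !in_itv /= andbT => -> h /=.
  by rewrite leNgt; apply: contra h => /ltW bt; rewrite tent_out // mulr0.
- by move=> t tt; rewrite mulr_ge0.
- by move=> t tr; rewrite tent_up // expr2.
- transitivity ((4 * (1 - s))%:E * \int[mu]_(t in `]0%R, +oo[) (tent rho b t)%:E)%E.
    congr (_ * _)%E; apply: eq_integral => t; rewrite inE /= in_itv /= andbT => tp.
    by rewrite mulrAC mulfV ?mul1r // gt_eqF.
  rewrite integral_tent // -EFinM; congr EFin; rewrite /b.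
  by field; rewrite !gt_eqF // subr_gt0.
Qed.

End test_function.

(** * The infimum of the operator over the class *)

Section infimum.
Context {R : realType}.
Variables (n : nat) (s rho : R) (chi : R -> R).
Hypotheses (s01 : 0 < s < 1) (hrho : admissible_radius s rho).
Hypothesis (hchi : admissible_profile s rho chi).
Local Notation u := (u_chi (ord0 : 'I_n.+2) s chi).

Let s0 : 0 < s. Proof. by case/andP: s01. Qed.

Definition op_scale : R := @C_const R n.+2 s * ((n.+2%:R + 2 * s) * profile_mass s).

Lemma op_scale_gt0 : 0 < op_scale.
Proof.
apply: mulr_gt0; first exact: C_const_gt0.
apply: mulr_gt0; last exact: profile_mass_gt0 s01.
by rewrite addr_gt0 ?mulr_gt0.
Qed.

Lemma L_op_ball (A : 'M[R]_n.+2) : A2_class A ->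
  L_op s A u 0 = (op_scale%:E * ball_int (op_density s A))%E.
Proof. by move=> [Apd _]; rewrite (L_op_eq s01 hrho hchi Apd). Qed.

Definition degenerate_average : R := fine (ball_int (@axial_density R n.+1 s 0)).

Lemma degenerate_averageE :
  ball_int (@axial_density R n.+1 s 0) = degenerate_average%:E.
Proof. by rewrite fineK // ball_int_axial_fin // ltW. Qed.

Lemma degenerate_average_gt0 : 0 < degenerate_average.
Proof. by rewrite -lte_fin -degenerate_averageE ball_int_axial_gt0. Qed.

Definition ball_volume : R := fine (intRn (fun y : 'cV[R]_n.+2 => (unit_ball y)%:E)).

Lemma ball_volumeE : intRn (fun y : 'cV[R]_n.+2 => (unit_ball y)%:E) = ball_volume%:E.
Proof. by rewrite fineK // intRn_unit_ball_fin. Qed.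

Lemma ball_volume_gt0 : 0 < ball_volume.
Proof. by rewrite -lte_fin -ball_volumeE intRn_unit_ball_gt0. Qed.

Lemma L_op_ge0 (A : 'M[R]_n.+2) : A2_class A -> (0 <= L_op s A u 0)%E.
Proof.
move=> AA2; rewrite L_op_ball // mule_ge0 ?lee_fin ?(ltW op_scale_gt0) //.
by apply: ball_int_ge0 => y; exact: op_density_ge0.
Qed.

Lemma L_op_ge (A : 'M[R]_n.+2) : A2_class A ->
  ((op_scale * degenerate_average)%:E <= L_op s A u 0)%E.
Proof.
move=> AA2; rewrite L_op_ball // EFinM -degenerate_averageE.
apply: lee_wpmul2l; first by rewrite lee_fin; exact: ltW op_scale_gt0.
apply: le_trans (ball_int_op_ge (ltW s0) AA2); apply: le_ball_int.
- exact: colmeas_axial_density.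
- exact: colmeas_axial_density.
- by move=> y; exact: axial_density_ge0.
- by move=> y _; apply: axial_density_mono; rewrite ?lexx ?sqr_ge0 // ltW.
Qed.

(** Up to the scale, the excess over the infimum is at most t^(-s) times the
    volume of the ball. *)
Lemma L_op_degenerate_le (t : R) : 1 <= t ->
  (L_op s (degenerate_mx n t) u 0 <=
   (op_scale * (degenerate_average + t `^ (- s) * ball_volume))%:E)%E.
Proof.
move=> t1; rewrite L_op_ball; last by apply: degenerate_A2; exact: lt_le_trans t1.
rewrite [leRHS]EFinM lee_pmul2l ?lte_fin ?op_scale_gt0 //.
apply: le_trans (degenerate_ball_int_le n s01 t1) _.
by rewrite degenerate_averageE ball_volumeE -EFinM -EFinD.
Qed.

Lemma inf_L_op : ereal_inf [set L_op s A u 0 | A in A2_class] =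
  (op_scale * degenerate_average)%:E.
Proof.
apply/eqP; rewrite eq_le; apply/andP; split; last first.
  by apply: le_ereal_inf_tmp => _ [A AA2 <-]; exact: L_op_ge.
apply/lee_addgt0Pr => e e0.
(* The error op_scale * ball_volume * t^(-s) is at most e as soon as
   t^s >= c. *)
pose c := op_scale * ball_volume / e.
have c0 : 0 < c by rewrite divr_gt0 // mulr_gt0 ?op_scale_gt0 ?ball_volume_gt0.
pose t := Num.max 1 (c `^ s^-1).
have t1 : 1 <= t by rewrite le_max lexx.
have t0 : 0 < t by exact: lt_le_trans t1.
apply: (@le_trans _ _ (L_op s (degenerate_mx n t) u 0)).
  by apply: ereal_inf_lbound; exists (degenerate_mx n t) => //; exact: degenerate_A2.
apply: le_trans (L_op_degenerate_le t1) _.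
rewrite -EFinD lee_fin mulrDr lerD2l mulrCA mulrC.
have ct : c <= t `^ s.
  have -> : c = (c `^ s^-1) `^ s by rewrite -powRrM mulVf ?gt_eqF // powRr1 // ltW.
  by apply: ge0_ler_powR; rewrite ?nnegrE ?powR_ge0 ?(ltW s0) ?(ltW t0) // le_max lexx orbT.
rewrite powRN ler_pdivrMr ?powR_gt0 //.
by move: ct; rewrite /c ler_pdivrMr // [leRHS]mulrC.
Qed.

(** On [N_class L] the operator is bounded below by the axial average with
    [c = L^-4], and this exceeds the average with [c = 0], a gap uniform in
    [A]. *)
Lemma inf_L_op_N (L : R) : 1 <= L ->
  (ereal_inf [set L_op s A u 0 | A in A2_class] <
   ereal_inf [set L_op s A u 0 | A in A2_class `&` N_class L])%E.
Proof.
move=> L1; have L0 : 0 < L by exact: lt_le_trans L1.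
have c0 : 0 < L ^- 4 by rewrite invr_gt0 exprn_gt0.
apply: (@lt_le_trans _ _ (op_scale%:E * ball_int (@axial_density R n.+1 s (L ^- 4)))%E).
  rewrite inf_L_op EFinM -degenerate_averageE lte_pmul2l ?lte_fin ?op_scale_gt0 //.
  by apply: ball_int_axial_gap => //; exact: ltW.
apply: le_ereal_inf_tmp => _ [A [AA2 AN] <-]; rewrite (L_op_ball AA2).
apply: lee_wpmul2l; first by rewrite lee_fin; exact: ltW op_scale_gt0.
by apply: ball_int_op_N => //; exact: ltW.
Qed.

Lemma L_op_degenerate_bounded (t : R) : 1 <= t ->
  (`|L_op s (degenerate_mx n t) u 0| <= (op_scale * (degenerate_average + ball_volume))%:E)%E.
Proof.
move=> t1; have t0 : 0 < t by exact: lt_le_trans t1.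
rewrite gee0_abs; last by apply: L_op_ge0; exact: degenerate_A2.
apply: le_trans (L_op_degenerate_le t1) _; rewrite lee_fin ler_wpM2l ?(ltW op_scale_gt0) //.
rewrite lerD2l ler_piMl ?(ltW ball_volume_gt0) //.
by rewrite -(powRr0 t) ler_powR // oppr_le0 ltW.
Qed.

Lemma no_frobenius_bound (gamma0 : R) : 0 < gamma0 ->
  ~ (forall A : 'M[R]_n.+2, A2_class A ->
      ((gamma0 * frobenius A `^ (2 * s))%:E <= L_op s A u 0)%E).
Proof.
move=> g0 H; pose M := op_scale * (degenerate_average + ball_volume).
have M0 : 0 < M.
  by rewrite mulr_gt0 ?op_scale_gt0 // addr_gt0 ?degenerate_average_gt0 ?ball_volume_gt0.
(* Along the family the right-hand side is at most M, while
   frobenius ^ (2 s) >= t^s; a t with t^s >= c violates the estimate. *)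
pose c := (M + 1) / gamma0.
have c0 : 0 < c by rewrite divr_gt0 // addr_gt0.
pose t := Num.max 1 (c `^ s^-1).
have t1 : 1 <= t by rewrite le_max lexx.
have t0 : 0 < t by exact: lt_le_trans t1.
have ct : c <= t `^ s.
  have -> : c = (c `^ s^-1) `^ s by rewrite -powRrM mulVf ?gt_eqF // powRr1 // ltW.
  by apply: ge0_ler_powR; rewrite ?nnegrE ?powR_ge0 ?(ltW s0) ?(ltW t0) // le_max lexx orbT.
have fr : t `^ s <= frobenius (degenerate_mx n t) `^ (2 * s).
  have -> : t `^ s = Num.sqrt t `^ (2 * s).
    by rewrite -powR12_sqrt ?ltW // -powRrM; congr powR; field.
  apply: ge0_ler_powR; rewrite ?nnegrE ?sqrtr_ge0 ?mulr_ge0 ?(ltW s0) //.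
  exact: degenerate_frobenius_ge.
have := le_trans (H _ (degenerate_A2 n t0)) (le_trans (lee_abs _) (L_op_degenerate_bounded t1)).
rewrite lee_fin -/M leNgt => /negP; apply.
apply: (@lt_le_trans _ _ (M + 1)); first by rewrite ltrDl.
rewrite mulrC -ler_pdivrMr //; exact: le_trans ct fr.
Qed.

End infimum.

Lemma degenerate_frobenius_cvg (R : realType) (n : nat) :
  frobenius (degenerate_mx n (Num.max 1 lam : R)) @[lam --> +oo] --> +oo.
Proof.
apply/cvgryPge => X; near=> lam.
apply: (@le_trans _ _ (Num.sqrt (Num.max 1 lam))); last first.
  by apply: degenerate_frobenius_ge; rewrite lt_max ltr01.
apply: (le_trans (ler_norm X)); rewrite -sqrtr_sqr ler_wsqrtr // le_max.
by apply/orP; right; near: lam; apply: nbhs_pinfty_ge; exact: num_real.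
Unshelve. all: by end_near. Qed.

Lemma degenerate_small_eigenvalue (R : realType) (n : nat) (eps : R) : 0 < eps ->
  \forall lam \near +oo,
    exists2 a : R, eigenvalue (degenerate_mx n (Num.max 1 lam)) a & a < eps.
Proof.
move=> e0; near=> lam.
have t0 : 0 < Num.max 1 lam by rewrite lt_max ltr01.
exists (Num.sqrt (Num.max 1 lam)^-1); first exact: degenerate_eigenvalue.
rewrite -[ltRHS]gtr0_norm // -sqrtr_sqr ltr_sqrt ?exprn_gt0 //.
rewrite invf_plt ?posrE ?exprn_gt0 // lt_max.
by apply/orP; right; near: lam; apply: nbhs_pinfty_gt; exact: num_real.
Unshelve. all: by end_near. Qed.

Theorem proposition8p1 (R : realType) (n : nat) (hn : (2 < n)%N) (s : R)
    (hs : 0 < s < 1) :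
  (exists rho : R, admissible_radius s rho) /\
  forall rho : R, admissible_radius s rho ->
  (exists chi : R -> R, admissible_profile s rho chi) /\
  forall chi : R -> R, admissible_profile s rho chi ->
  let u : 'cV[R]_n -> R := u_chi (Ordinal (ltnW (ltnW hn))) s chi in
  [/\ Cc_on setT u,
      touched_from_above_C2 u 0,
      exists2 eta0 : R, 0 < eta0 & K_op s u 0 = eta0%:E
    & forall e : 'cV[R]_n, enorm e = 1 ->
        (0 <= Theta_op s u 0 e)%E /\ (Theta_op s u 0 e <= 1)%E] /\
  [/\ forall Lambda : R, 1 <= Lambda ->
        (ereal_inf [set L_op s A u 0 | A in A2_class] <
         ereal_inf [set L_op s A u 0 | A in A2_class `&` N_class Lambda])%E /\
        ereal_inf [set L_op s A u 0 | A in A2_class] = K_op s u 0,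
      forall gamma0 : R, 0 < gamma0 ->
        ~ (forall A : 'M[R]_n, A2_class A ->
             ((gamma0 * frobenius A `^ (2 * s))%:E <= L_op s A u 0)%E)
    & exists A_ : R -> 'M[R]_n,
        [/\ forall lam, A2_class (A_ lam),
            frobenius (A_ lam) @[lam --> +oo] --> +oo,
            forall eps : R, 0 < eps ->
              \forall lam \near +oo,
                exists2 a : R, eigenvalue (A_ lam) a & a < eps
          & exists M : R, forall lam, (`|L_op s (A_ lam) u 0| <= M%:E)%E]].
Proof.
split; first exact: exists_radius.
move=> rho hrho; split; first exact: exists_profile hs hrho.
case: n hn => [//|[//|n]] hn chi hchi.
rewrite (_ : Ordinal _ = ord0); last exact/val_inj.
move=> u; split; split.
- exact: (u_Cc hs hrho hchi).
- exact: (u_touched hs hrho hchi).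
- exists (op_scale n s * degenerate_average n s); last exact: (inf_L_op n hs hrho hchi).
  by rewrite mulr_gt0 ?(op_scale_gt0 n hs) // (degenerate_average_gt0 n hs).
- exact: (Theta_op_bounds hs hrho hchi).
- by move=> L L1; split; [exact: (inf_L_op_N n hs hrho hchi)|].
- exact: (no_frobenius_bound hs hrho hchi).
have t1 (lam : R) : 1 <= Num.max 1 lam by rewrite le_max lexx.
exists (fun lam => degenerate_mx n (Num.max 1 lam)); split.
- by move=> lam; apply: degenerate_A2; exact: lt_le_trans (t1 lam).
- exact: degenerate_frobenius_cvg.
- exact: degenerate_small_eigenvalue.
- exists (op_scale n s * (degenerate_average n s + ball_volume n)) => lam.
  exact: (L_op_degenerate_bounded n hs hrho hchi).
Qed.
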